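(* Let $m,n$ be positive integers satisfying $$\frac mn\notin\left(\tfrac12,2\right),\qquad (m,n)\notin\{(1,3),(3,1),(2,4),(4,2)\}.$$ Let $\|\cdot\|_1$ be any norm on $\mathbb{R}^n$ and $\|\cdot\|_2$ any norm on $\mathbb{R}^m$. Then $$\dim_H FS_{m,n}(\|\cdot\|_1,\|\cdot\|_2)\ \ge\ (\max\{m,n\}-2)\cdot\min\{m,n\}=mn-2\min\{m,n\}.$$ Moreover, the same bound holds when restricting to those $\Omega\in FS_{m,n}(\|\cdot\|_1,\|\cdot\|_2)$ such that (i) $\Omega$ has full $\mathbb{R}$-rank $\min\{m,n\}$ and (ii) the set of all entries of $\Omega$ together with $1$ is linearly independent over $\mathbb{Q}$. Furthermore, the Dirichlet spectrum $\mathcal{D}_{m,n}(\|\cdot\|_1,\|\cdot\|_2)$ accumulates at $0$; in particular, it is not finite.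
   Context: For norms $\|\cdot\|_1$ on $\mathbb{R}^n$ and $\|\cdot\|_2$ on $\mathbb{R}^m$, $\Omega\in\mathbb{R}^{m\times n}$ and $t\ge1$ let $$\psi_\Omega(t)=\min\{\|\Omega\hat{\boldsymbol b}+\tilde{\boldsymbol b}\|_2:\hat{\boldsymbol b}\in\mathbb{Z}^n,\ \tilde{\boldsymbol b}\in\mathbb{Z}^m,\ 1\le\|\hat{\boldsymbol b}\|_1\le t\},$$ $\Theta(\Omega)=\limsup_{t\to\infty}t^{n/m}\psi_\Omega(t)$, $\widetilde\Theta(\Omega)=\liminf_{t\to\infty}t^{n/m}\psi_\Omega(t)$, and $D=\sup_{\Omega\in\mathbb{R}^{m\times n}}\Theta(\Omega)<\infty$ (all depending on the norms). Put $Di_{m,n}(\|\cdot\|_1,\|\cdot\|_2)=\{\Omega:\Theta(\Omega)<D\}$, $Sing_{m,n}=\{\Omega:\Theta(\Omega)=0\}$, $Bad_{m,n}=\{\Omega:\widetilde\Theta(\Omega)>0\}$ (the last two do not depend on the norms), and $$FS_{m,n}(\|\cdot\|_1,\|\cdot\|_2)=Di_{m,n}(\|\cdot\|_1,\|\cdot\|_2)\setminus(Bad_{m,n}\cup Sing_{m,n}).$$ The Dirichlet spectrum is $\mathcal{D}_{m,n}(\|\cdot\|_1,\|\cdot\|_2)=\{\Theta(\Omega):\Omega\in\mathbb{R}^{m\times n}\}\subseteq[0,D]$. In (ii), the $mn$ entries and $1$ are meant as a family of $mn+1$ real numbers. $\dim_H$ denotes Hausdorff dimension. *)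

(* Defs.v *)
From HB Require Import structures.
From mathcomp Require Import all_boot all_order all_algebra.
From mathcomp Require Import all_classical all_reals all_analysis.
Import Order.TTheory GRing.Theory Num.Theory.
Import numFieldNormedType.Exports.

Set Implicit Arguments.
Unset Strict Implicit.
Unset Printing Implicit Defensive.

Local Open Scope classical_set_scope.
Local Open Scope ring_scope.

Record is_norm (R : realType) (V : lmodType R) (N : V -> R) : Prop := IsNorm {
  is_norm_triangle : forall x y, N (x + y) <= N x + N y ;
  is_norm_scale : forall (a : R) x, N (a *: x) = `|a| * N x ;
  is_norm_definite : forall x, N x = 0 -> x = 0
}.

Section HausdorffDimension.
Context {R : realType} {V : normedModType R}.
Local Open Scope ereal_scope.

Definition diameter (A : set V) : \bar R :=
  ereal_sup [set (`|x - y|%R)%:E | x in A & y in A].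

(* The supremum over the empty set is -oo, so the empty set, whose gauge is 0
   for every s, is treated apart. A nonempty set has gauge 1 when s = 0. *)
Definition hausdorff_gauge (s : R) (A : set V) : \bar R :=
  if A == set0 then 0 else poweR (diameter A) s.

Definition hausdorff_premeasure (s d : R) (A : set V) : \bar R :=
  ereal_inf [set \sum_(i <oo) hausdorff_gauge s (U i) | U in
    [set U : nat -> set V |
      A `<=` \bigcup_i U i /\ forall i, diameter (U i) <= d%:E]].

Definition hausdorff_measure (s : R) (A : set V) : \bar R :=
  ereal_sup [set hausdorff_premeasure s d A | d in [set d : R | (0 < d)%R]].

(* With this convention the empty set has dimension 0. On 'M[R]_(m, n) the
   library norm is the largest absolute value of an entry; any other norm,
   the Euclidean one included, is Lipschitz equivalent and gives the same
   dimension. *)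
Definition hausdorff_dim (A : set V) : \bar R :=
  ereal_inf [set s%:E | s in
    [set s : R | (0 <= s)%R /\ hausdorff_measure s A = 0]].

End HausdorffDimension.

Section DirichletSpectrum.
Context {R : realType} {m n : nat}.
Variables (N1 : 'cV[R]_n -> R) (N2 : 'cV[R]_m -> R).

Definition int_vec {k : nat} (b : 'cV[int]_k) : 'cV[R]_k := map_mx intr b.

(* When some integer vector satisfies 1 <= N1 b <= t, which is the case for all
   large t, the infimum is a minimum: finitely many b are admissible, and the
   values N2 (W b + c), c integral, are discrete. The value is +oo otherwise. *)
Definition psi (W : 'M[R]_(m, n)) (t : R) : \bar R :=
  ereal_inf [set (N2 (W *m int_vec bc.1 + int_vec bc.2))%:E | bc in
    [set bc : 'cV[int]_n * 'cV[int]_m | 1 <= N1 (int_vec bc.1) <= t]].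

Definition scaled_psi (W : 'M[R]_(m, n)) (t : R) : \bar R :=
  ((t `^ (n%:R / m%:R))%:E * psi W t)%E.

Definition Theta (W : 'M[R]_(m, n)) : \bar R :=
  limf_esup (scaled_psi W) (pinfty_nbhs R).

Definition Theta_inf (W : 'M[R]_(m, n)) : \bar R :=
  limf_einf (scaled_psi W) (pinfty_nbhs R).

Definition dirichlet_spectrum : set (\bar R) := range Theta.

Definition dirichlet_const : \bar R := ereal_sup dirichlet_spectrum.

Definition Di : set 'M[R]_(m, n) :=
  [set W | (Theta W < dirichlet_const)%E].

Definition Sing : set 'M[R]_(m, n) := [set W | Theta W = 0%E].

Definition Bad : set 'M[R]_(m, n) := [set W | (0 < Theta_inf W)%E].

Definition FS : set 'M[R]_(m, n) := Di `\` (Bad `|` Sing).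

End DirichletSpectrum.

(* A family and not a set: repeated entries count as a linear relation. *)
Definition entries_and_one_Q_free (R : realType) (m n : nat)
    (W : 'M[R]_(m, n)) : Prop :=
  forall (q0 : rat) (q : 'M[rat]_(m, n)),
    ratr q0 + \sum_i \sum_j ratr (q i j) * W i j = 0 -> q0 = 0 /\ q = 0.

(* Main.v *)
Require Import Defs.
From HB Require Import structures.
From mathcomp Require Import all_boot all_order all_algebra.
From mathcomp Require Import all_classical all_reals all_analysis.
From mathcomp Require Import measurable_realfun.
From mathcomp Require Import ring lra zify.
Import Order.TTheory GRing.Theory Num.Theory.
Import numFieldNormedType.Exports.

(* Assume n >= 2m, put w = n/m >= 2, and fix two columns A as follows. Let Q_k
   be powers of 2 (k even) and of 3 (k odd) with Q_k / Q_{k+2} comparable to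
   c Q_{k+1}^-w, and let the columns of A be the sums of u_k / Q_k over even and
   over odd k, with suitable 0/1 vectors u_k. Then Q_k times the column of the
   parity of k is within O(c Q_{k+1}^-w) of an integral vector, which bounds
   Theta by O(c) and makes A not badly approximable, while coprimality of Q_k and
   Q_{k+1} shows that nothing below Q_{k+1} does better. For a matrix (A | B), the
   set of B in a unit cube for which an integral vector of size t that involves B
   beats delta t^-w has measure O(delta^m). Hence, for a set of B of positive
   measure, (A | B) has no such vector for infinitely many of the critical t, so
   that 0 < Theta(A | B) = O(c), and a set of positive Lebesgue measure has full
   dimension m(n - 2). The case m >= 2n follows by transposition: a pigeonhole
   transference argument carries the three approximation properties over to the
   transposed matrix. Since c is arbitrary, Theta takes arbitrarily small positive
   values, which are in particular smaller than its supremum. *)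

Set Implicit Arguments.
Unset Strict Implicit.
Unset Printing Implicit Defensive.

Local Open Scope classical_set_scope.
Local Open Scope ring_scope.

(** * The two-column block *)

(** A single column cannot carry the construction: if it has an irrational entry, its error is at
    least of order [1 / t] at arbitrarily large [t], so no exponent [w >= 2] holds uniformly. Two
    columns that take turns escape this obstacle, and they account for the 2 in [n - 2]. The
    condition [w >= 2] enters when two consecutive levels are compared: multiplication by
    [Q k.+1 * Q k.+2] yields an integer up to an error of order [c] times [Q k.+2] to the power
    [2 - w], which has to be less than 1. The same comparison proves independence over the
    rationals, one digit vector at a time. In the random part each critical scale admits a set of
    [B] of measure at least 1/2; the sets of different scales need not be independent, but their
    limit superior still has measure at least 1/2. Positive mass is all that the dimension bound
    asks for. Full rank comes from translating the cube by a matrix with a large diagonal. *)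

Lemma pow_sandwich (R : realType) (p : nat) (x : R) : (1 < p)%N -> 1 <= x ->
  exists l : nat, x <= (p ^ l)%:R <= p%:R * x.
Proof.
move=> p1 x1.
have ex : exists l : nat, x <= (p ^ l)%:R :> R.
  exists (Num.bound x).
  apply: le_trans (ltW (archi_boundP (le_trans ler01 x1))) _.
  by rewrite ler_nat ltnW // ltn_expl.
exists (ex_minn ex); case: ex_minnP => -[|l] xl lmin; rewrite xl /=.
  rewrite expn0; apply: (le_trans x1).
  by apply: ler_peMl; [exact: le_trans ler01 x1|rewrite ler1n ltnW].
rewrite expnS natrM ler_pM2l ?ltr0n ?(ltnW p1) //.
case: (leP x (p ^ l)%:R) => [/lmin|/ltW //]; first by rewrite ltnn.
Qed.

(** The sum is the supremum of the partial sums [S]. As [S J + 2 * y J] is nonincreasing in [J],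
    each of these numbers bounds every partial sum. *)
Lemma lacunary_sum (R : realType) (v y : R^nat) :
  (forall j, 0 <= v j <= y j) -> (forall j, y j.+1 <= y j / 2) ->
  exists s : R, forall J, 0 <= s - \sum_(j < J) v j <= 2 * y J.
Proof.
move=> hv hy; pose S J : R := \sum_(j < J) v j.
have SS J : S J.+1 = S J + v J by rewrite /S big_ord_recr.
have Smono I J : (I <= J)%N -> S I <= S J.
  elim: J => [|J IH]; first by rewrite leqn0 => /eqP ->.
  rewrite leq_eqVlt => /predU1P[-> //|/IH le]; apply: le_trans le _.
  by rewrite SS lerDl; case/andP: (hv J).
have S2 I J : (I <= J)%N -> S J + 2 * y J <= S I + 2 * y I.
  elim: J => [|J IH]; first by rewrite leqn0 => /eqP ->.
  rewrite leq_eqVlt => /predU1P[-> //|/IH]; rewrite SS.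
  by have := hv J; have := hy J; lra.
have y0 j : 0 <= y j by case/andP: (hv j) => a b; exact: le_trans b.
have ub J I : S I <= S J + 2 * y J.
  case/orP: (leq_total I J) => [/Smono|/S2]; [have := y0 J|have := y0 I]; lra.
have hs : has_sup (range S).
  by split; [exists (S 0%N), 0%N|exists (S 0%N + 2 * y 0%N) => _ [I _ <-]].
exists (sup (range S)) => J; rewrite subr_ge0 lerBlDl; apply/andP; split.
  by apply: ub_le_sup; [case: hs|exists J].
by apply: ge_sup; [case: hs|move=> _ [I _ <-]; exact: ub].
Qed.

Definition level_base (k : nat) : nat := if odd k then 3 else 2.

Lemma level_baseSS k : level_base k.+2 = level_base k.
Proof. by rewrite /level_base /= negbK. Qed.

Lemma level_base_gt1 k : (1 < level_base k)%N.
Proof. by rewrite /level_base; case: odd. Qed.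

Lemma coprime_level_base k : coprime (level_base k) (level_base k.+1).
Proof. by rewrite /level_base /=; case: odd. Qed.

Lemma powR_ge_sqr (R : realType) (w x : R) : 2 <= w -> 1 <= x -> x ^+ 2 <= x `^ w.
Proof.
by move=> w2 x1; rewrite -powR_mulrn ?(le_trans ler01 x1) //; exact: ler_powR.
Qed.

(** Given levels [k] and [k.+1], [Q k] is multiplied by a power of its own base between [x] and
    [3 * x], where [x] is [Q k.+1] to the power [w], divided by [c]. The larger base 3 is the loss
    in the second bound. From [w >= 2] and [c <= 4^-1] follows [x >= 4 * Q k.+1 ^ 2], hence the
    third bound. *)
Lemma level_exponents (R : realType) (w c : R) : 2 <= w -> 0 < c -> c <= 4^-1 ->
  exists e : nat -> nat, let Q k := (level_base k ^ e k)%N in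
  [/\ forall k, (Q k)%:R / (Q k.+2)%:R <= c * (Q k.+1)%:R `^ (- w),
      forall k, c / 3 * (Q k.+1)%:R `^ (- w) <= (Q k)%:R / (Q k.+2)%:R,
      forall k, (4 * Q k.+1 ^ 2 <= Q k.+2)%N &
      forall k, (e k < e k.+2)%N].
Proof.
move=> w2 c0 c14.
have /choice[l hl] : forall z : nat * R, exists l : nat,
    1 <= z.2 -> z.2 <= (level_base z.1 ^ l)%:R <= 3 * z.2.
  move=> [k x] /=; case: (leP 1 x) => x1; last by exists 0%N.
  have [l] := @pow_sandwich R (level_base k) x (level_base_gt1 k) x1.
  case/andP=> xl lx; exists l => _; rewrite xl /=; apply: le_trans lx _.
  by rewrite ler_pM2r ?(lt_le_trans ltr01 x1) // ler_nat /level_base; case: odd.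
(* The state is [(k, (e k, e k.+1))], started with both exponents 0. *)
pose step (z : nat * (nat * nat)) : nat * (nat * nat) :=
  (z.1.+1, (z.2.2, z.2.1 + l (z.1, (level_base z.1.+1 ^ z.2.2)%:R `^ w / c)))%N.
pose s k := iter k step (0, (0, 0))%N.
have s1 k : (s k).1 = k by elim: k => //= k ->.
pose e k := (s k).2.1; exists e => Q.
pose x k : R := (Q k.+1)%:R `^ w / c.
have Q0 j : (0 < Q j)%N by rewrite expn_gt0 ltnW ?level_base_gt1.
have Q1 j : 1 <= (Q j)%:R :> R by rewrite ler1n.
have eSS k : e k.+2 = (e k + l (k, x k))%N by rewrite /e /= !s1.
have QSS k : Q k.+2 = (Q k * level_base k ^ l (k, x k))%N.
  by rewrite /Q eSS level_baseSS expnD.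
have x4 k : 4 * (Q k.+1)%:R ^+ 2 <= x k.
  rewrite /x ler_pdivlMr //; apply: (le_trans _ (powR_ge_sqr w2 (Q1 k.+1))).
  by rewrite mulrAC ler_piMl ?sqr_ge0 //; lra.
have x4' k : 4 <= x k.
  by apply: (le_trans _ (x4 k)); have := exprn_ege1 2 (Q1 k.+1); lra.
have /= hx k := hl (k, x k) (le_trans (ler1n _ 4) (x4' k)).
have Qx k : x k * (Q k)%:R <= (Q k.+2)%:R <= 3 * x k * (Q k)%:R.
  by rewrite QSS natrM [_ * (_ ^ _)%:R]mulrC !ler_pM2r ?ltr0n.
have xV k : c * (Q k.+1)%:R `^ (- w) = (x k)^-1.
  by rewrite /x powRN invf_div.
have x0 k : 0 < x k by apply: (lt_le_trans _ (x4' k)).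
split=> k.
- rewrite xV ler_pdivrMr ?ltr0n // mulrC ler_pdivlMr //.
  by rewrite mulrC; case/andP: (Qx k).
- rewrite mulrAC xV ler_pdivlMr ?ltr0n //; case/andP: (Qx k) => _ h.
  have -> : (Q k)%:R = (x k)^-1 / 3 * (3 * x k * (Q k)%:R) :> R.
    by field; rewrite gt_eqF.
  by rewrite ler_pM2l // divr_gt0 ?invr_gt0.
- rewrite -(ler_nat R) natrM natrX; case/andP: (Qx k) => h _.
  apply: (le_trans _ h); apply: (le_trans (x4 k)).
  by rewrite ler_peMr // ltW.
- rewrite eSS -[ltnLHS]addn0 ltn_add2l lt0n; apply/eqP => l0.
  by have := hx k; rewrite l0 expn0; have := x4' k; lra.
Qed.

(* The first entry of every digit vector is 1, which keeps the numerators of the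
   first row coprime to the denominators; the other entry equal to 1 moves
   cyclically, so that infinitely many levels of each parity see every index. *)
Definition digit m (k : nat) (i : 'I_m.+1) : bool :=
  (i == 0%N :> nat) || (i == (k./2 %% m.+1)%N :> nat).

(** [a p] sums the digits over the levels of parity [p], and [xi k] is the tail beyond level [k].
    From one level to the next of the same parity the numerator is multiplied by a positive power of
    the base and a digit is added; in row 0 that digit is 1, so the numerator stays 1 modulo the
    base. *)
Lemma level_expansion (R : realType) m (e : nat -> nat) :
  (forall k, e k < e k.+2)%N ->
  let Q k := (level_base k ^ e k)%N in
  exists (a : bool -> 'I_m.+1 -> R) (xi : nat -> 'I_m.+1 -> R),
  [/\ forall k i, exists P : nat, a (odd k) i = P%:R / (Q k)%:R + xi k i /\
        (i == ord0 -> coprime P (level_base k)),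
      forall k i, 0 <= xi k i <= 2 / (Q k.+2)%:R &
      forall k i, xi k i = (digit k.+2 i)%:R / (Q k.+2)%:R + xi k.+2 i].
Proof.
move=> elt Q.
have Q0 j : (0 < Q j)%N by rewrite expn_gt0 ltnW ?level_base_gt1.
have QSS k : Q k.+2 = (Q k * level_base k ^ (e k.+2 - e k))%N.
  by rewrite /Q level_baseSS -expnD subnKC // ltnW.
pose lev (p : bool) j := (j.*2 + p)%N.
have levS p j : lev p j.+1 = (lev p j).+2 by rewrite /lev doubleS.
have levP k : lev (odd k) k./2 = k by rewrite /lev addnC odd_double_half.
have levO p j : odd (lev p j) = p by rewrite /lev oddD odd_double; case: p.
have lev2 p j : (lev p j)./2 = j by rewrite /lev addnC half_bit_double.
pose v (z : bool * 'I_m.+1) j : R :=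
  (digit (lev z.1 j) z.2)%:R / (Q (lev z.1 j))%:R.
have /choice[s hs] : forall z, exists s : R,
    forall J, 0 <= s - \sum_(j < J) v z j <= 2 * (Q (lev z.1 J))%:R^-1.
  move=> [p i]; apply: lacunary_sum => j /=.
    rewrite divr_ge0 //= ler_piMl ?invr_ge0 //.
    by case: digit.
  rewrite levS QSS natrM invfM ler_pM2l ?invr_gt0 ?ltr0n //.
  rewrite lef_pV2 ?posrE ?ltr0n ?expn_gt0 ?(ltnW (level_base_gt1 _)) //.
  rewrite ler_nat (leq_trans (level_base_gt1 (lev p j))) //.
  by rewrite -[leqLHS]expn1 leq_exp2l ?level_base_gt1 // subn_gt0.
exists (fun p i => s (p, i)).
exists (fun k i => s (odd k, i) - \sum_(j < k./2.+1) v (odd k, i) j).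
split=> k i.
- pose S J := \sum_(j < J.+1) v (odd k, i) j.
  suff : forall J, exists P : nat, S J = P%:R / (Q (lev (odd k) J))%:R /\
      (i == ord0 -> coprime P (level_base (lev (odd k) J))).
    move=> /(_ k./2)[P []]; rewrite levP => SP cP; exists P; split=> //.
    by rewrite -SP /S addrC subrK.
  elim=> [|J [P [SP cP]]].
    exists (digit (lev (odd k) 0) i); split; first by rewrite /S big_ord1.
    by move=> /eqP ->; rewrite /digit eqxx coprime1n.
  exists (P * level_base (lev (odd k) J) ^
    (e (lev (odd k) J).+2 - e (lev (odd k) J)) +
    digit (lev (odd k) J).+2 i)%N; split.
    rewrite /S big_ord_recr /= -/(S J) SP levS QSS /v /= levS QSS !natrD !natrM.
    by field; rewrite !pnatr_eq0 -!lt0n Q0 expn_gt0 ltnW ?level_base_gt1.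
  move=> /eqP ->; rewrite levS level_baseSS coprime_sym /coprime /digit eqxx.
  have /subnK <- : (0 < e (lev (odd k) J).+2 - e (lev (odd k) J))%N.
    by rewrite subn_gt0.
  by rewrite expnD expn1 mulnA gcdnMDl gcdn1.
- have /= := hs (odd k, i) k./2.+1; by rewrite levS levP.
- rewrite /= negbK [in RHS]big_ord_recr /=.
  have -> : v (odd k, i) k./2.+1 = (digit k.+2 i)%:R / (Q k.+2)%:R.
    by rewrite /v /= levS levP.
  ring.
Qed.

(** Coordinates replace the two norms, and [b != 0] replaces a norm at least 1. This changes only
    constants, which [scaled_psi_le] and [scaled_psi_ge] account for. *)
Definition solvable_at (R : realType) m n (W : 'M[R]_(m, n)) (t c : R) : Prop :=
  exists (b : 'cV[int]_n) (d : 'cV[int]_m),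
  [/\ b != 0, forall j, `|(b j 0)%:~R| <= t &
      forall i, `|(W *m int_vec b + int_vec d) i 0| <= c].

Lemma solvable_at_le (R : realType) m n (W : 'M[R]_(m, n)) (t t' c c' : R) :
  t <= t' -> c <= c' -> solvable_at W t c -> solvable_at W t' c'.
Proof.
move=> tt' cc' [b [d [b0 bt bc]]]; exists b, d; split=> // i.
  exact: le_trans tt'.
exact: le_trans cc'.
Qed.

Lemma mulmx_int_vecE (R : realType) m n (W : 'M[R]_(m, n))
    (b : 'cV[int]_n) (d : 'cV[int]_m) i :
  (W *m int_vec b + int_vec d) i 0
  = \sum_j W i j * (b j 0)%:~R + (d i 0)%:~R.
Proof. by rewrite !mxE; congr (_ + _); apply: eq_bigr => j _; rewrite mxE. Qed.

Lemma ge0_powR_opp_le (R : realType) (w x y : R) : 0 <= w -> 0 < x -> x <= y ->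
  y `^ (- w) <= x `^ (- w).
Proof.
move=> w0 x0 xy; rewrite !powRN lef_pV2 ?posrE ?powR_gt0 ?(lt_le_trans x0) //.
by apply: ge0_ler_powR; rewrite ?nnegrE // ?(le_trans _ xy) // ltW.
Qed.

Lemma common_denominator (I : finType) (q : I -> rat) :
  exists (D : int) (g : I -> int), D != 0 /\ forall i, (g i)%:~R = D%:~R * q i.
Proof.
exists (\prod_i denq (q i)).
exists (fun i => numq (q i) * \prod_(j | j != i) denq (q j)); split.
  by apply/prodf_neq0 => i _; exact: denq_neq0.
move=> i; rewrite [in RHS](bigD1 i) //= !intrM numqE.
by ring.
Qed.

Section TwoColumns.
Context {R : realType} (m : nat).
Variables (w c : R) (e : nat -> nat) (a : bool -> 'I_m.+1 -> R).
Variable (xi : nat -> 'I_m.+1 -> R).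
Let Q k := (level_base k ^ e k)%N.
Hypotheses (w2 : 2 <= w) (c0 : 0 < c) (c14 : c <= 4^-1).
Hypothesis Qub : forall k, (Q k)%:R / (Q k.+2)%:R <= c * (Q k.+1)%:R `^ (- w).
Hypothesis Qlb : forall k,
  c / 3 * (Q k.+1)%:R `^ (- w) <= (Q k)%:R / (Q k.+2)%:R.
Hypothesis Qsqr : forall k, (4 * Q k.+1 ^ 2 <= Q k.+2)%N.
Hypothesis aP : forall k i, exists P : nat, a (odd k) i = P%:R / (Q k)%:R + xi k i
  /\ (i == ord0 -> coprime P (level_base k)).
Hypothesis xi_bound : forall k i, 0 <= xi k i <= 2 / (Q k.+2)%:R.
Hypothesis xi_rec : forall k i,
  xi k i = (digit k.+2 i)%:R / (Q k.+2)%:R + xi k.+2 i.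

Definition two_columns : 'M[R]_(m.+1, 2) := \matrix_(i, j) a (odd j) i.
Let A := two_columns.
Let col (k : nat) : 'I_2 := inord (odd k).

Let Qgt0 k : (0 < Q k)%N.
Proof. by rewrite expn_gt0 ltnW ?level_base_gt1. Qed.

Let QR0 k : 0 < (Q k)%:R :> R.
Proof. by rewrite ltr0n. Qed.

Let QR1 k : 1 <= (Q k)%:R :> R.
Proof. by rewrite ler1n. Qed.

Let Q_le k : (Q k.+1 <= Q k.+2)%N.
Proof. by apply: leq_trans (Qsqr k); have := Qgt0 k.+1; nia. Qed.

Let Q_large k : (k <= Q k.+1)%N.
Proof.
elim: k => // k IH; apply: leq_trans (Qsqr k); have := Qgt0 k.+1; nia.
Qed.

Let two_columnsE k (b : 'cV[int]_2) (d : 'cV[int]_m.+1) i :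
  (A *m int_vec b + int_vec d) i 0 = a (odd k) i * (b (col k) 0)%:~R +
    a (odd k.+1) i * (b (col k.+1) 0)%:~R + (d i 0)%:~R.
Proof.
have c0E : ord0 = inord false :> 'I_2 by apply/val_inj; rewrite /= inordK.
have c1E : lift ord0 ord0 = inord true :> 'I_2.
  by apply/val_inj; rewrite /= inordK.
rewrite mulmx_int_vecE big_ord_recl big_ord1 c1E c0E !mxE !inordK //.
by congr (_ + _); rewrite /col /=; case: (odd k) => //=; rewrite addrC.
Qed.

Let Qpow_le1 k : (Q k)%:R `^ (- w) * (Q k)%:R ^+ 2 <= 1 :> R.
Proof.
rewrite powRN ler_pdivrMl ?powR_gt0 // mulr1; exact: powR_ge_sqr.
Qed.

Lemma two_columns_solvable k :
  solvable_at A (Q k)%:R (2 * c * (Q k.+1)%:R `^ (- w)).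
Proof.
have /choice[P hP] := aP k.
exists (\col_j if j == col k then (Q k)%:Z else 0), (\col_i - (P i)%:Z); split.
- apply/eqP => /matrixP/(_ (col k) 0); rewrite !mxE eqxx => -[] /eqP.
  by rewrite -leqn0 leqNgt Qgt0.
- by move=> j; rewrite !mxE; case: eqP => _; rewrite ?normr0 // ger0_norm.
- move=> i; rewrite (two_columnsE k) !mxE eqxx.
  have /negPf -> : col k.+1 != col k.
    by rewrite -val_eqE /= !inordK ?ltnS ?leq_b1 //=; case: (odd k).
  have [-> _] := hP i; rewrite mulr0 addr0 mulrDl mulfVK ?gt_eqF //.
  rewrite mulrNz addrAC subrr add0r ger0_norm; last first.
    by rewrite mulr_ge0 //; case/andP: (xi_bound k i).
  apply: le_trans (_ : 2 / (Q k.+2)%:R * (Q k)%:R <= _).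
    by rewrite ler_pM2r; [case/andP: (xi_bound k i)|exact: QR0].
  by rewrite -[leLHS]mulrA -mulrA ler_pM2l // mulrC.
Qed.

(** Between [Q k.+1] and [Q k.+2] the solution of level [k.+1] serves throughout, because its error
    is measured by the right end [Q k.+2]. *)
Lemma two_columns_uniform t : (Q 1)%:R <= t ->
  solvable_at A t (2 * c * t `^ (- w)).
Proof.
move=> Qt; have t0 : 0 < t by apply: lt_le_trans Qt.
have ex : exists k, t < (Q k.+1)%:R.
  exists (Num.bound t); apply: lt_le_trans (archi_boundP (ltW t0)) _.
  by rewrite ler_nat.
case: (ex_minnP ex) => -[|k] tk kmin; first by rewrite ltNge Qt in tk.
have Qkt : (Q k.+1)%:R <= t.
  by rewrite leNgt; apply/negP => /kmin; rewrite ltnn.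
apply: solvable_at_le Qkt _ (two_columns_solvable _).
rewrite ler_pM2l ?mulr_gt0 //; apply: ge0_powR_opp_le (ltW tk) => //.
exact: le_trans w2.
Qed.

(** At [t = Q k.+1] the error is governed by [Q k.+2 >= Q k.+1 ^ 2]; this gains a second factor [t]
    to the power [- w], which is at most [1 / Q k.+1 <= eps]. *)
Lemma two_columns_not_bad eps t0 : 0 < eps ->
  exists2 t, t0 <= t & solvable_at A t (eps * t `^ (- w)).
Proof.
move=> eps0; pose x := Num.max t0 eps^-1; pose k := Num.bound x.
have xk : x <= (Q k.+1)%:R.
  have x0 : 0 <= x by rewrite le_max invr_ge0 (ltW eps0) orbT.
  by apply: le_trans (ltW (archi_boundP x0)) _; rewrite ler_nat.
exists (Q k.+1)%:R; first by apply: le_trans xk; rewrite le_max lexx.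
apply: solvable_at_le (lexx _) _ (two_columns_solvable _).
have w0 : 0 <= w by apply: le_trans w2.
have h1 : (Q k.+2)%:R `^ (- w) <= ((Q k.+1)%:R * (Q k.+1)%:R) `^ (- w) :> R.
  apply: ge0_powR_opp_le; rewrite ?mulr_gt0 //.
  rewrite -natrM ler_nat; apply: leq_trans (Qsqr k); nia.
have h2 : eps^-1 <= (Q k.+1)%:R by apply: le_trans xk; rewrite le_max lexx orbT.
have h3 : (Q k.+1)%:R `^ (- w) <= eps.
  rewrite -[eps]invrK; apply: (@le_trans _ _ (Q k.+1)%:R^-1).
    have := Qpow_le1 k.+1; rewrite expr2 mulrA -ler_pdivlMr // div1r.
    by apply: le_trans; rewrite ler_peMr // powR_ge0.
  by rewrite lef_pV2 ?posrE ?invr_gt0.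
apply: (@le_trans _ _ (1 * (Q k.+2)%:R `^ (- w))).
  by rewrite ler_pM2r ?powR_gt0 //; have := c14; lra.
rewrite mul1r; apply: le_trans h1 _; rewrite powRM ?(ltW (QR0 _)) //.
by rewrite ler_pM2r // powR_gt0.
Qed.

(** Just before level [k.+2] comes into reach, row 0 alone leaves only multiples of the older
    denominator [Q k.+1]. Their error is at least [Q k.+1 / Q k.+3], and [c / 6] lies below the
    [c / 3] of [Qlb]. *)
Lemma two_columns_not_uniform k : ~ solvable_at A ((Q k.+2)%:R / 2)
  (c / 6 * (Q k.+2)%:R `^ (- w)).
Proof.
set q := Q k.+1; set q' := Q k.+2 => -[b [d [b0 bt /(_ ord0)]]].
rewrite (two_columnsE k.+1); set x := b _ 0; set y := b _ 0; set z := d _ _.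
have [P [-> /(_ (eqxx _)) cP]] := aP k.+1 ord0.
have [P' [-> /(_ (eqxx _)) cP']] := aP k.+2 ord0.
have := xi_bound k.+1 ord0; have := xi_bound k.+2 ord0.
rewrite -/q -/q'; set u := xi k.+1 _; set v := xi k.+2 _ => hv hu hV.
set q3 := Q k.+3 in hu; have hxt : `|x%:~R| <= q'%:R / 2 :> R by exact: bt.
have hyt : `|y%:~R| <= q'%:R / 2 :> R by exact: bt.
have q0 : 0 < q%:R :> R by exact: QR0.
have q'0 : 0 < q'%:R :> R by exact: QR0.
have q30 : 0 < q3%:R :> R by exact: QR0.
have hv' : 0 <= v <= 2 / q3%:R.
  case/andP: hv => -> /= hv; apply: le_trans hv _.
  by rewrite ler_pM2l // lef_pV2 ?posrE ?QR0 // ler_nat; exact: Q_le.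
have pw := Qpow_le1 k.+2; rewrite -/q' in pw, hV.
set p := q'%:R `^ _ in pw, hV; have p0 : 0 < p by rewrite powR_gt0.
have qub : q%:R / q3%:R <= c * p by exact: Qub.
have qq' : q%:R <= q'%:R :> R by rewrite ler_nat; exact: Q_le.
(* Multiplication by [q * q'] clears the denominators of both truncated expansions: [N] is the
   integral part of the result, and the tails [u] and [v] make up the rest. *)
pose N : int := x * P%:Z * q'%:Z + y * P'%:Z * q%:Z + z * q%:Z * q'%:Z.
set V := (X in `|X| <= _) in hV.
have NE : N%:~R = q%:R * q'%:R * V - q%:R * q'%:R * (x%:~R * u + y%:~R * v) :> R.
  rewrite /N /V !rmorphD !rmorphM /=; field.
  by rewrite !gt_eqF.
have tail : `|x%:~R * u + y%:~R * v| <= 2 * q'%:R / q3%:R.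
  have hm (s t : R) : `|s| <= q'%:R / 2 -> 0 <= t <= 2 / q3%:R ->
      `|s * t| <= q'%:R / q3%:R.
    move=> hs /andP[t0 ht]; rewrite normrM (ger0_norm t0).
    apply: le_trans (ler_pM (normr_ge0 _) t0 hs ht) _.
    by rewrite mulrA divfK // pnatr_eq0.
  apply: le_trans (ler_normD _ _) _.
  by rewrite -mulrA mulrDl mul1r lerD // hm.
(* The contributions of [V] and of the tails are at most 1/4 and 1/2, so the integer [N] is less
   than 1 in absolute value. *)
have N0 : N = 0.
  apply/eqP; rewrite -normr_eq0 -[_ == 0]negbK; apply/negP => Nn.
  have N1 : 1 <= `|N%:~R| :> R.
    by rewrite -intr_norm -[1]/(1%:~R) ler_int -gtz0_ge1 normr_gt0 -normr_eq0.
  have h1 : `|q%:R * q'%:R * V| <= 4^-1 :> R.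
    rewrite normrM [`|_ * q'%:R|]gtr0_norm ?mulr_gt0 //.
    apply: (@le_trans _ _ (q%:R * q'%:R * (c / 6 * p))).
      by rewrite ler_pM2l // mulr_gt0.
    have h : q%:R * q'%:R * p <= 1.
      by apply: le_trans pw; rewrite mulrC expr2 ler_pM2l // ler_pM2r.
    have -> : q%:R * q'%:R * (c / 6 * p) = c / 6 * (q%:R * q'%:R * p) by ring.
    by have := c0; have := c14; nra.
  have h2 : `|q%:R * q'%:R * (x%:~R * u + y%:~R * v)| <= 2^-1 :> R.
    rewrite normrM [`|q%:R * _|]gtr0_norm ?mulr_gt0 //.
    apply: (@le_trans _ _ (q%:R * q'%:R * (2 * q'%:R / q3%:R))).
      by rewrite ler_pM2l // mulr_gt0.
    have -> : q%:R * q'%:R * (2 * q'%:R / q3%:R)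
      = 2 * (q%:R / q3%:R) * q'%:R ^+ 2 :> R by ring.
    have h : q%:R / q3%:R * q'%:R ^+ 2 <= c * p * q'%:R ^+ 2 :> R.
      by rewrite ler_pM2r // exprn_gt0.
    by have := c0; have := c14; nra.
  have := ler_normB (q%:R * q'%:R * V) (q%:R * q'%:R * (x%:~R * u + y%:~R * v)).
  by rewrite -NE; lra.
have cqq' : coprime q' q.
  by rewrite coprimeXl // coprimeXr // coprime_sym coprime_level_base.
have cq'P' : coprime q' P' by rewrite coprimeXl // coprime_sym.
have cqP : coprime q P by rewrite coprimeXl // coprime_sym.
(* Modulo [q'] the equation [N = 0] leaves [y * P' * q], with [P' * q] prime to [q']; the bound
   [q' / 2] then excludes the nonzero multiples of [q']. *)
have y0 : y = 0.
  have dy : (q'%:Z %| y)%Z.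
    rewrite -(@Gauss_dvdzl _ _ (P' * q)%:Z) ?coprimezE ?absz_nat ?coprimeMr ?cq'P' //.
    apply/dvdzP; exists (- (x * P%:Z + z * q%:Z)).
    by rewrite PoszM -[LHS]subr0 -N0 /N; ring.
  apply/eqP; rewrite -[_ == 0]negbK; apply/negP => yn.
  rewrite dvdzE absz_nat in dy; rewrite -absz_gt0 in yn.
  have := dvdn_leq yn dy; rewrite -(ler_nat R) natr_absz => hq.
  by move: hyt hq; rewrite -intr_norm; have := QR0 k.+2; rewrite -/q'; lra.
have xn : x != 0.
  apply/eqP => x0; case/eqP: b0; apply/matrixP => i j; rewrite ord1 mxE.
  have : i = col k.+1 \/ i = col k.+2.
    rewrite /col /=; case: i => -[|[|//]] i2 /=.
      case: (odd k) => /=; [left|right]; apply/val_inj; by rewrite /= inordK.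
    case: (odd k) => /=; [right|left]; apply/val_inj; by rewrite /= inordK.
  by case=> ->.
(* With [y = 0] a factor [q'] cancels, and the same argument modulo [q] applies to [x]. *)
have dx : (q%:Z %| x)%Z.
  rewrite -(@Gauss_dvdzl _ _ P%:Z) ?coprimezE //.
  apply/dvdzP; exists (- z); apply/eqP.
  have q'n : q'%:Z != 0 by rewrite eqz_nat -lt0n Qgt0.
  rewrite -(inj_eq (mulIf q'n)); apply/eqP.
  by rewrite -[LHS]subr0 -N0 /N y0; ring.
have xq : q%:R <= `|x%:~R| :> R.
  rewrite -intr_norm -natr_absz ler_nat dvdn_leq ?absz_gt0 //.
have VE : V = x%:~R * u.
  have : N%:~R = 0 :> R by rewrite N0.
  rewrite NE y0 mul0r addr0 -mulrBr => /eqP.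
  by rewrite mulf_eq0 subr_eq0 mulf_eq0 (gt_eqF q0) (gt_eqF q'0) => /eqP.
(* The digit of row 0 at level [k.+3] is 1. *)
have ulb : q3%:R^-1 <= u.
  rewrite /u xi_rec /digit eqxx mul1r lerDl.
  by case/andP: (xi_bound k.+3 ord0).
have := Qlb k.+1; rewrite -/q -/q' -/q3 -/p => hlb.
have : q%:R / q3%:R <= `|V|.
  rewrite VE normrM; apply: ler_pM => //; rewrite ?invr_ge0 ?(ltW q30) //.
  exact: (le_trans ulb (ler_norm _)).
have := mulr_gt0 c0 p0; move: hV; lra.
Qed.

(** * Integral relations between 1 and the entries of the block *)

Section Relation.
Variables (g0 : int) (g : 'I_m.+1 -> 'I_2 -> int).
Hypothesis rel : g0%:~R + \sum_i \sum_j (g i j)%:~R * A i j = 0 :> R.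
Let G : R := \sum_i \sum_j `|(g i j)%:~R|.

Let G_ge0 : 0 <= G.
Proof. by apply: sumr_ge0 => i _; apply: sumr_ge0 => j _. Qed.

Let sum_cols (V : zmodType) (F : 'I_m.+1 -> 'I_2 -> V) k :
  \sum_i \sum_j F i j = \sum_i (F i (col k) + F i (col k.+1)).
Proof.
apply: eq_bigr => i _; rewrite big_ord_recl big_ord1.
have c0E : ord0 = inord false :> 'I_2 by apply/val_inj; rewrite /= inordK.
have c1E : lift ord0 ord0 = inord true :> 'I_2.
  by apply/val_inj; rewrite /= inordK.
by rewrite c1E c0E /col /=; case: (odd k) => //=; rewrite addrC.
Qed.

Let combination_bound k (u v : 'I_m.+1 -> R) (x : R) :
  (forall i, 0 <= u i <= x) -> (forall i, 0 <= v i <= x) ->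
  `|\sum_i ((g i (col k))%:~R * u i + (g i (col k.+1))%:~R * v i)| <= G * x.
Proof.
move=> hu hv; rewrite /G (sum_cols _ k) mulr_suml.
apply: le_trans (ler_norm_sum _ _ _) _; apply: ler_sum => i _.
apply: le_trans (ler_normD _ _) _; rewrite mulrDl !normrM.
case/andP: (hu i) => u0 ux; case/andP: (hv i) => v0 vx.
by rewrite (ger0_norm u0) (ger0_norm v0) lerD // ler_wpM2l.
Qed.

(** After multiplication by [q * q'] the relation says that an integer plus [q * q' * S] is 0, and
    the latter is less than 1 once [q > 2 * G]. Hence the tails satisfy the relation without its
    constant term. *)
Let level_relation k : 2 * G < (Q k.+1)%:R ->
  \sum_i ((g i (col k.+1))%:~R * xi k.+1 i +
          (g i (col k.+2))%:~R * xi k.+2 i) = 0.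
Proof.
move=> Gq; set q := Q k.+1; set q' := Q k.+2; set S := \sum_i _.
have q0 : 0 < q%:R :> R by exact: QR0.
have q'0 : 0 < q'%:R :> R by exact: QR0.
have q30 : 0 < (Q k.+3)%:R :> R by exact: QR0.
have /choice[P hP] := aP k.+1; have /choice[P' hP'] := aP k.+2.
pose N : int := q%:Z * q'%:Z * g0 +
  \sum_i (g i (col k.+1) * (P i)%:Z * q'%:Z + g i (col k.+2) * (P' i)%:Z * q%:Z).
have NE : N%:~R + q%:R * q'%:R * S = 0 :> R.
  have colE j : odd (col j) = odd j by rewrite /col inordK; case: (odd j).
  rewrite -[RHS](mulr0 (q%:R * q'%:R)) -rel (sum_cols _ k.+1) mulrDr.
  rewrite /N rmorphD !rmorphM /= -addrA; congr (_ + _).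
  rewrite rmorph_sum !mulr_sumr -big_split; apply: eq_bigr => i _ /=.
  rewrite !mxE !colE (proj1 (hP i)) (proj1 (hP' i)) rmorphD !rmorphM /= -/q -/q'.
  by field; rewrite !gt_eqF.
have Sle : `|S| <= G * (2 / (Q k.+3)%:R).
  apply: combination_bound => i; first exact: xi_bound.
  case/andP: (xi_bound k.+2 i) => -> /= h; apply: le_trans h _.
  by rewrite ler_pM2l // lef_pV2 ?posrE ?QR0 // ler_nat; exact: Q_le.
have pw := Qpow_le1 k.+2; have qub := Qub k.+1; rewrite -/q' -/q in pw, qub.
have h : `|q%:R * q'%:R * S| < 1.
  rewrite normrM gtr0_norm ?mulr_gt0 //.
  apply: (@le_lt_trans _ _ (q%:R * q'%:R * (G * (2 / (Q k.+3)%:R)))).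
    by rewrite ler_pM2l // mulr_gt0.
  have -> : q%:R * q'%:R * (G * (2 / (Q k.+3)%:R)) =
      2 * G * (q%:R / (Q k.+3)%:R) * q'%:R by ring.
  have h1 : 2 * G * (q%:R / (Q k.+3)%:R) * q'%:R <=
      q%:R * (c * q'%:R `^ (- w)) * q'%:R.
    rewrite ler_pM2r //; apply: ler_pM qub; last exact: ltW.
      by rewrite mulr_ge0.
    by rewrite divr_ge0 // ltW.
  apply: le_lt_trans h1 _; apply: (@le_lt_trans _ _ c); last by have := c14; lra.
  have -> : q%:R * (c * q'%:R `^ (- w)) * q'%:R =
    c * (q'%:R `^ (- w) * (q'%:R * q%:R)) by ring.
  rewrite ler_piMr ?(ltW c0) //; apply: le_trans pw; rewrite expr2.
  by rewrite ler_pM2l ?powR_gt0 // ler_pM2l // ler_nat; exact: Q_le.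
have N0 : N = 0.
  apply/eqP; rewrite -normr_eq0 -[_ == 0]negbK; apply/negP => Nn.
  have : 1 <= `|N%:~R| :> R.
    by rewrite -intr_norm -[1]/(1%:~R) ler_int -gtz0_ge1 normr_gt0 -normr_eq0.
  by move/eqP: NE; rewrite addr_eq0 => /eqP ->; rewrite normrN leNgt h.
move/eqP: NE; rewrite N0 add0r mulf_eq0 mulf_eq0 (gt_eqF q0) (gt_eqF q'0).
by move/eqP.
Qed.

(** With the leading digit split off, [s / Q k.+3] is balanced by tails of size at most
    [2 * G / Q k.+4]; since [Q k.+4 >= Q k.+3 ^ 2], the integer [s] is less than 1 in absolute
    value. *)
Lemma digit_relation k : 2 * G < (Q k.+1)%:R ->
  \sum_i g i (col k.+1) * (digit k.+3 i)%:Z = 0.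
Proof.
move=> Gq; have := level_relation Gq.
have c3 : col k.+3 = col k.+1 by rewrite /col /= !negbK.
set s := \sum_i _ * _%:Z.
have q30 : 0 < (Q k.+3)%:R :> R by exact: QR0.
have -> : \sum_i ((g i (col k.+1))%:~R * xi k.+1 i +
      (g i (col k.+2))%:~R * xi k.+2 i) = s%:~R / (Q k.+3)%:R +
    \sum_i ((g i (col k.+2))%:~R * xi k.+2 i +
      (g i (col k.+3))%:~R * xi k.+3 i).
  rewrite rmorph_sum /= mulr_suml -big_split; apply: eq_bigr => i _ /=.
  by rewrite c3 (xi_rec k.+1) rmorphM /=; ring.
set T := (X in _ + X); move/eqP; rewrite addr_eq0 => /eqP sT.
have Tle : `|T| <= G * (2 / (Q k.+4)%:R).
  apply: combination_bound => i; first exact: xi_bound.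
  case/andP: (xi_bound k.+3 i) => -> /= h; apply: le_trans h _.
  by rewrite ler_pM2l // lef_pV2 ?posrE ?QR0 // ler_nat; exact: Q_le.
have sE : s%:~R = - T * (Q k.+3)%:R.
  by rewrite -sT divfK // gt_eqF.
have h : `|s%:~R| < 1 :> R.
  rewrite sE normrM normrN [`|_%:R|]gtr0_norm //.
  apply: (@le_lt_trans _ _ (G * (2 / (Q k.+4)%:R) * (Q k.+3)%:R)).
    by rewrite ler_pM2r.
  rewrite [ltLHS](_ : _ = 2 * G * (Q k.+3)%:R / (Q k.+4)%:R); last by ring.
  rewrite ltr_pdivrMr ?QR0 // mul1r.
  apply: (@lt_le_trans _ _ ((Q k.+3)%:R * (Q k.+3)%:R)).
    rewrite ltr_pM2r //; apply: lt_le_trans Gq _; rewrite ler_nat.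
    by apply: leq_trans (Q_le k) (Q_le k.+1).
  by rewrite -natrM ler_nat; apply: leq_trans (Qsqr k.+2); nia.
apply/eqP; rewrite -[_ == 0]negbK; apply/negP => sn.
suff : 1 <= `|s%:~R| :> R by rewrite leNgt h.
by rewrite -intr_norm -[1]/(1%:~R) ler_int -gtz0_ge1 normr_gt0.
Qed.

(** Row 0 always has digit 1, and the moving 1 visits every row at arbitrarily high levels of each
    parity. Its visit to row 0 isolates [g ord0 j], after which its visit to row [i] isolates
    [g i j]. *)
Lemma relation_coef0 i j : g i j = 0.
Proof.
have oddE (l : 'I_2) : odd l = l :> nat by case: l => -[|[|//]].
pose L := (Num.bound (2 * G)).+4.
have big k : (L <= k.+4)%N -> 2 * G < (Q k.+1)%:R.
  rewrite !ltnS => Lk; have G2 : 0 <= 2 * G by rewrite mulr_ge0.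
  apply: lt_le_trans (archi_boundP G2) _.
  by rewrite ler_nat; apply: leq_trans Lk (Q_large k).
have rel_at (l : 'I_m.+1) : \sum_i g i j * ((i == 0%N :> nat) || (i == l))%:Z = 0.
  (* This level has the parity of [j], lies beyond the threshold [L], and its half is [l] modulo
     [m.+1]. *)
  pose k := ((l + m.+1 * L).*2 + j)%N.
  have kL : (L + 2 <= k)%N by rewrite /k /L; nia.
  have kE : k = k.-2.-1.+3 by rewrite /k /L; lia.
  have Lk : (L <= (k.-2.-1).+4)%N by lia.
  have := digit_relation (big _ Lk).
  have -> : col (k.-2.-1).+1 = j.
    apply: ord_inj; rewrite /col inordK; last by case: odd.
    have -> : odd (k.-2.-1).+1 = odd k by rewrite [in RHS]kE /= !negbK.
    by rewrite /k oddD odd_double -[RHS]oddE.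
  rewrite -kE => h; rewrite -[RHS]h; apply: eq_bigr => i' _.
  rewrite /digit; have -> : k./2 = (l + m.+1 * L)%N.
    by rewrite /k addnC -oddE half_bit_double.
  by rewrite addnC mulnC modnMDl modn_small.
have g00 : g ord0 j = 0.
  have := rel_at ord0; rewrite (bigD1 ord0) //= mulr1 big1 ?addr0 // => i' i'0.
  by rewrite -val_eqE /= orbb; move: i'0; rewrite -val_eqE /= => /negPf ->; rewrite mulr0.
have [-> //|i0] := eqVneq i ord0.
have := rel_at i; rewrite (bigD1 ord0) //= g00 mul0r add0r (bigD1 i) //=.
rewrite eqxx orbT mulr1 big1 ?addr0 // => i' /andP[i'0 i'i].
move: i'0; rewrite (negPf i'i) -val_eqE /= => /negPf ->.
by rewrite mulr0.
Qed.

End Relation.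

Lemma two_columns_Q_free : entries_and_one_Q_free two_columns.
Proof.
move=> q0 q hq.
have [D [g [D0 gE]]] := common_denominator
  (fun z : option ('I_m.+1 * 'I_2) => if z is Some z then q z.1 z.2 else q0).
have gR z : (g z)%:~R = D%:~R *
    ratr (if z is Some z then q z.1 z.2 else q0) :> R.
  have -> : (g z)%:~R = ratr ((g z)%:~R : rat) :> R by rewrite ratr_int.
  by rewrite gE rmorphM /= ratr_int.
pose h i j := g (Some (i, j)).
have hR i j : (h i j)%:~R = D%:~R * ratr (q i j) :> R := gR (Some (i, j)).
have rel : (g None)%:~R + \sum_i \sum_j (h i j)%:~R * A i j = 0 :> R.
  transitivity (D%:~R * (ratr q0 +
      \sum_i \sum_j ratr (q i j) * two_columns i j)); last by rewrite hq mulr0.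
  rewrite mulrDr (gR None); congr (_ + _).
  rewrite mulr_sumr;  apply: eq_bigr => i _; rewrite mulr_sumr.
  by apply: eq_bigr => j _; rewrite hR -mulrA.
have h0 := relation_coef0 rel.
have q00 z : g z = 0 -> (if z is Some z then q z.1 z.2 else q0) = 0.
  by move=> gz; have /eqP := gE z; rewrite gz eq_sym mulf_eq0 intr_eq0 (negPf D0) => /eqP.
split; last by apply/matrixP => i j; rewrite mxE; exact: (q00 (Some (i, j)) (h0 i j)).
apply: (q00 None); apply/eqP; rewrite -(intr_eq0 R); apply/eqP.
rewrite -[LHS]addr0 -[RHS]rel; congr (_ + _); apply/esym; apply: big1 => i _.
by apply: big1 => j _; rewrite h0 mul0r.
Qed.

End TwoColumns.

(** The three notions stand for [Theta] at most a multiple of [c], [Theta] at least a multiple of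
    [c], and [Theta_inf] not positive; see [Theta_le], [Theta_ge] and [not_Bad]. *)
Definition uniformly_solvable (R : realType) m n (w : R) (W : 'M[R]_(m, n)) (c : R) :=
  \forall t \near +oo, solvable_at W t (c * t `^ (- w)).

Definition often_unsolvable (R : realType) m n (w : R) (W : 'M[R]_(m, n)) (c : R) :=
  forall t0, exists2 t, t0 <= t & ~ solvable_at W t (c * t `^ (- w)).

Definition often_well_solvable (R : realType) m n (w : R) (W : 'M[R]_(m, n)) :=
  forall eps t0, 0 < eps -> exists2 t, t0 <= t & solvable_at W t (eps * t `^ (- w)).

Lemma exists_two_columns (R : realType) m (w c : R) : 2 <= w -> 0 < c ->
  exists A : 'M[R]_(m.+1, 2), [/\ uniformly_solvable w A c,
    exists2 c', 0 < c' & often_unsolvable w A c',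
    often_well_solvable w A & entries_and_one_Q_free A].
Proof.
move=> w2 c0; pose c1 := Num.min (c / 2) 4^-1.
have c10 : 0 < c1 by rewrite lt_min; apply/andP; split; lra.
have c14 : c1 <= 4^-1 by rewrite ge_min lexx orbT.
have c1c : 2 * c1 <= c by rewrite mulrC -ler_pdivlMr // ge_min lexx.
have [e [Qub Qlb Qsqr elt]] := level_exponents w2 c10 c14.
have [a [xi [aP xi_bound xi_rec]]] := @level_expansion R m e elt.
exists (two_columns a); split.
- exists (level_base 1 ^ e 1)%:R; split; first exact: num_real.
  move=> t /ltW Qt.
  have h := two_columns_uniform w2 c10 c14 Qub Qsqr aP xi_bound Qt.
  apply: (solvable_at_le (lexx _) _ h).
  by rewrite ler_wpM2r // powR_ge0.
(* The critical scale is [q / 2]; the power of 2 converts a bound in terms of [q / 2] into the one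
   of [two_columns_not_uniform] in terms of [q]. *)
- exists (c1 / 6 * 2 `^ (- w)); first by rewrite mulr_gt0 ?powR_gt0 // divr_gt0.
  move=> t0; pose k := Num.bound (2 * t0); pose q := (level_base k.+2 ^ e k.+2)%N.
  have kq : (k <= q)%N.
    have h j : (j <= level_base j.+1 ^ e j.+1)%N.
      elim: j => // j IH; apply: leq_trans (Qsqr j).
      by have : (0 < level_base j.+1 ^ e j.+1)%N; [rewrite expn_gt0 ltnW ?level_base_gt1|nia].
    by apply: leq_trans (h k.+1).
  exists (q%:R / 2).
    rewrite ler_pdivlMr // mulrC; have [t00|/ltW t00] := leP 0 (2 * t0).
      by apply: le_trans (ltW (archi_boundP t00)) _; rewrite ler_nat.
    exact: le_trans t00 _.
  rewrite -[X in ~ solvable_at _ _ X]mulrA -powRM ?divr_ge0 //.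
  rewrite [2 * _]mulrC divfK //.
  exact: (two_columns_not_uniform w2 c10 c14 Qub Qlb Qsqr aP xi_bound xi_rec).
- move=> eps t0 eps0.
  exact: (two_columns_not_bad w2 c10 c14 Qub Qsqr aP xi_bound t0 eps0).
- exact: (two_columns_Q_free w2 c10 c14 Qub Qsqr aP xi_bound xi_rec).
Qed.

(** * The uniform measure on the cube and Hausdorff dimension *)

Section UnitUniform.
Context {R : realType}.
Local Open Scope ereal_scope.

Definition unit_uniform : set (measurableTypeR R) -> \bar R :=
  mrestr lebesgue_measure (measurable_itv `[0%R, 1%R]).

HB.instance Definition _ := Measure.on unit_uniform.

Let unit_uniform_setT : unit_uniform setT = 1.
Proof.
by rewrite /unit_uniform /mrestr setTI lebesgue_measure_itv /= lte_fin ltr01 sube0.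
Qed.

HB.instance Definition _ :=
  Measure_isProbability.Build _ _ _ unit_uniform unit_uniform_setT.

Lemma unit_uniform_le A : measurable A -> unit_uniform A <= lebesgue_measure A.
Proof. by move=> mA; apply: le_measure; rewrite ?inE //; exact: measurableI. Qed.

Definition pair_cons k (z : k.-tuple (measurableTypeR R) * measurableTypeR R) :
  k.+1.-tuple (measurableTypeR R) := [tuple of z.2 :: z.1].

Let measurable_pair_cons k : measurable_fun setT (@pair_cons k).
Proof. exact: measurable_cons. Qed.

HB.instance Definition _ k :=
  isMeasurableFun.Build _ _ _ _ (@pair_cons k) (@measurable_pair_cons k).

(** The new coordinate goes to the head, so that it is integrated innermost and the tail carries the
    measure of the induction hypothesis. *)
Fixpoint cube_measure k : probability (k.-tuple (measurableTypeR R)) R :=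
  match k with
  | 0 => dirac [tuple]
  | S k => distribution (cube_measure k \x unit_uniform) (@pair_cons k)
  end.

Lemma cube_measureSE k A : cube_measure k.+1 A =
  \int[cube_measure k]_t unit_uniform [set x | A [tuple of x :: t]].
Proof.
rewrite /= /distribution /pushforward /product_measure1 /=.
apply: eq_integral => t _ /=; congr unit_uniform; rewrite /xsection /=.
by apply/seteqP; split=> x; rewrite /= inE.
Qed.
End UnitUniform.

Section Cylinders.
Context {R : realType}.
Notation mR := (measurableTypeR R).

Definition linear_cylinder k (J : pred 'I_k) (y : 'I_k -> R)
    (b : 'I_k -> 'I_k -> R) (E : 'I_k -> set R) : set (k.-tuple mR) :=
  [set t | forall l, J l -> E l (y l + \sum_i b l i * tnth t i)].

Lemma measurable_linear_cylinder k (J : pred 'I_k) y b E :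
  (forall l, measurable (E l : set mR)) -> measurable (@linear_cylinder k J y b E).
Proof.
move=> mE.
have -> : linear_cylinder J y b E = \bigcap_(l in [set l | J l])
    ((fun t : k.-tuple mR => y l + \sum_i b l i * tnth t i) @^-1` E l).
  by apply/seteqP; split=> t h l; [move/h|move/h].
apply: fin_bigcap_measurable => [|l _]; first exact: finite_finset.
rewrite -[X in measurable X]setTI; apply: (_ : measurable_fun setT _) => //.
apply: measurable_funD; first exact: measurable_cst.
apply: measurable_sum => i; apply: measurable_funM; first exact: measurable_cst.
exact: measurable_tnth.
exact: mE.
Qed.

(** Fubini for a triangular system: condition [l] does not involve the coordinates before [l], so
    coordinate 0 occurs in condition 0 alone. With the others fixed, its section has measure at most
    [eps] if 0 is in [J], and at most 1 otherwise; the remaining conditions form a system of the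
    same shape in the tail. *)
Lemma cube_measure_linear_cylinder k (J : pred 'I_k) y b E (eps : R) :
  0 <= eps -> (forall l, measurable (E l : set mR)) ->
  (forall l i : 'I_k, J l -> (i < l)%N -> b l i = 0) ->
  (forall l z, J l -> (unit_uniform [set x | E l (z + b l l * x)%R] <= eps%:E)%E) ->
  (cube_measure k (@linear_cylinder k J y b E) <= (eps ^+ #|J|)%:E)%E.
Proof.
move=> eps0; rewrite -prodr_const big_mkcond /=.
elim: k J y b E => [|k IH] J y b E mE b0 hE.
  rewrite big_ord0; apply: probability_le1.
  exact: measurable_linear_cylinder.
pose s (i : 'I_k) := lift ord0 i.
pose A' := @linear_cylinder k (J \o s) (y \o s) (fun l i => b (s l) (s i)) (E \o s).
have mA' : measurable A' by apply: measurable_linear_cylinder => l; exact: mE.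
pose e0 : R := if ord0 \in J then eps else 1.
have e00 : 0 <= e0 by rewrite /e0; case: ifP.
rewrite cube_measureSE big_ord_recl EFinM -/e0.
apply: (@le_trans _ _ (\int[cube_measure k]_t (e0%:E * (\1_A' t)%:E)))%E; last first.
  rewrite ge0_integralZl_EFin //; last first.
    by apply/measurable_EFinP; exact: measurable_indic.
  rewrite integral_indic // setIT lee_wpmul2l ?lee_fin //.
  apply: IH => [l|l i Jl il|l z Jl]; first exact: mE.
    by apply: b0.
  exact: hE.
have mA := measurable_linear_cylinder J y b mE.
have mSec (t : k.-tuple mR) :
    measurable [set x : mR | linear_cylinder J y b E [tuple of x :: t]].
  have := measurable_xsection t (measurable_funPTI (@pair_cons R k) mA).
  by congr measurable; apply/seteqP; split=> x; rewrite /xsection /= inE.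
have mS : measurable_fun setT (fun t : k.-tuple mR => unit_uniform [set x : mR |
    linear_cylinder J y b E [tuple of x :: t]]).
  have mP := measurable_funPTI (@pair_cons R k) mA.
  have := measurable_fun_xsection (unit_uniform (R := R)) mP.
  congr measurable_fun; apply/funext => t /=; congr unit_uniform.
  by apply/seteqP; split=> x; rewrite /xsection /= inE.
apply: ge0_le_integral => //.
  apply: measurable_funeM; apply/measurable_EFinP; exact: measurable_indic.
move=> t _; rewrite indicE; have [tA|tA] := boolP (t \in A'); last first.
  rewrite mule0 [X in unit_uniform X](_ : _ = set0) ?measure0 //.
  apply/seteqP; split=> x //= hx; case/negP: tA; rewrite inE => l Jl.
  have := hx (s l) Jl; rewrite big_ord_recl b0 // mul0r add0r.
  congr (E _ (_ + _)); apply: eq_bigr => i _.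
  by rewrite tnthS.
rewrite mule1 /e0; case: ifPn => J0; last by apply: probability_le1; exact: mSec.
apply: le_trans (hE ord0 (y ord0 + \sum_(i < k) b ord0 (s i) * tnth t i) J0).
apply: le_measure; rewrite ?inE.
- exact: mSec.
- rewrite -[X in measurable X]setTI; apply: (_ : measurable_fun setT _) => //.
  apply: measurable_funD; first exact: measurable_cst.
  by apply: measurable_funM; first exact: measurable_cst.
  exact: mE.
- move=> x /= /(_ ord0 J0); rewrite big_ord_recl; congr (E _ _).
  rewrite -addrA; congr (_ + _); rewrite addrC; congr (_ + _).
  by apply: eq_bigr => i _; rewrite tnthS.
Qed.
End Cylinders.

Section HausdorffLowerBound.
Context {R : realType}.
Notation mR := (measurableTypeR R).

Lemma cube_measure_box k (c : k.-tuple mR) (d : R) : 0 <= d ->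
  exists B : set (k.-tuple mR), [/\ measurable B,
    (forall t, (forall l, `|tnth t l - tnth c l| <= d) -> B t) &
    (cube_measure k B <= ((2 * d) ^+ k)%:E)%E].
Proof.
move=> d0; pose b (l i : 'I_k) : R := (l == i)%:R.
pose E (l : 'I_k) : set mR := [set` `[tnth c l - d, tnth c l + d]].
have mE l : measurable (E l) by exact: measurable_itv.
exists (linear_cylinder xpredT (fun=> 0) b E); split.
- exact: measurable_linear_cylinder.
- move=> t ht l _; rewrite add0r (bigD1 l) //= big1 => [|i il]; last first.
    by rewrite /b eq_sym (negPf il) mul0r.
  rewrite /b eqxx mul1r addr0 /E /= in_itv /=.
  by have := ht l; rewrite ler_norml; lra.
- rewrite -[X in (_ ^+ X)%R](card_ord k); apply: cube_measure_linear_cylinder.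
  + by rewrite mulr_ge0.
  + by [].
  + by move=> l i _ il; rewrite /b -val_eqE gtn_eqF.
  + move=> l z _; rewrite /b eqxx.
    have -> : [set x | E l (z + 1 * x)%R] =
        [set` `[tnth c l - d - z, tnth c l + d - z]].
      by apply/seteqP; split=> x; rewrite /E /= !in_itv /=; lra.
    apply: le_trans (unit_uniform_le (measurable_itv _)) _.
    rewrite lebesgue_measure_itv /= lte_fin; case: ltP => h; last first.
      by rewrite lee_fin mulr_ge0.
    by rewrite lee_fin; lra.
Qed.

Lemma hausdorff_dim_ge0 (V : normedModType R) (A : set V) : (0 <= hausdorff_dim A)%E.
Proof. by apply: le_ereal_inf_tmp => _ [s [s0 _] <-]; rewrite lee_fin. Qed.

Lemma hausdorff_dim_le (V : normedModType R) (A B : set V) :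
  A `<=` B -> (hausdorff_dim A <= hausdorff_dim B)%E.
Proof.
move=> AB; apply: ereal_inf_le_tmp => _ [s [s0 sB] <-]; exists s => //; split=> //.
have nonneg d (C : set V) : (0 <= hausdorff_premeasure s d C :> \bar R)%E.
  apply: le_ereal_inf_tmp => _ [U _ <-]; apply: nneseries_ge0 => i _ _.
  by rewrite /hausdorff_gauge; case: ifP => // _; exact: poweR_ge0.
apply/eqP; rewrite eq_le; apply/andP; split; last first.
  apply: (le_trans (nonneg 1 A)).
  by apply: ereal_sup_ubound; exists 1 => //=.
rewrite -sB; apply: ge_ereal_sup => _ [d /= d0 <-].
apply: (@le_trans _ _ (hausdorff_premeasure s d B)); last first.
  by apply: ereal_sup_ubound; exists d.
apply: ereal_inf_le_tmp => _ [U [BU Ud] <-]; exists U => //; split=> //.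
exact: subset_trans BU.
Qed.

(** Mass distribution principle. By the bound on [F], the preimage of a piece of diameter [d <= 1]
    lies in a box of half-side [d], whose measure is at most [2 ^ k * d ^ k <= 2 ^ k * d ^ s] when
    [s < k]. A cover with gauge sum below [mu S / 2 ^ k] would therefore carry too little mass to
    cover [S]. *)
Lemma hausdorff_dim_ge_cube (V : normedModType R) k (S : set (k.-tuple mR))
    (F : k.-tuple mR -> V) (A : set V) :
  measurable S -> (0 < cube_measure k S)%E -> (forall x, S x -> A (F x)) ->
  (forall x x' l, `|tnth x l - tnth x' l| <= `|F x - F x'|) ->
  (k%:R%:E <= hausdorff_dim A)%E.
Proof.
move=> mS S0 SA Flip; apply: le_ereal_inf_tmp => _ [s [s0 sA] <-].
rewrite lee_fin leNgt; apply/negP => sk.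
have k0 : (0 < k)%N by rewrite -(ltr0n R); apply: le_lt_trans sk.
set mu := cube_measure k in S0 *.
have muSfin : mu S \is a fin_num by exact: fin_num_measure.
pose eps := fine (mu S) / 2 ^+ k.
have eps0 : 0 < eps.
  by rewrite divr_gt0 ?exprn_gt0 // fine_gt0 // S0 /= ltey_eq muSfin.
have : (hausdorff_premeasure s 1 A < eps%:E)%E.
  apply: (@le_lt_trans _ _ 0%E); last by rewrite lte_fin.
  by rewrite -sA; apply: ereal_sup_ubound; exists 1 => //=.
move=> /ereal_inf_lt[_ [U [AU Ud] <-] sumU].
pose d i := fine (diameter (U i)).
have diam_ge i x y : U i x -> U i y -> ((`|x - y|)%:E <= diameter (U i))%E.
  by move=> Ux Uy; apply: ereal_sup_ubound; exists x => //; exists y.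
have dE i x : U i x -> [/\ diameter (U i) = (d i)%:E, 0 <= d i & d i <= 1].
  move=> Ux; have h0 := diam_ge i x x Ux Ux; rewrite subrr normr0 in h0.
  have dfin : diameter (U i) \is a fin_num.
    by rewrite ge0_fin_numE //; apply: le_lt_trans (Ud i) _; exact: ltey.
  have e : diameter (U i) = (d i)%:E by rewrite /d fineK.
  by split=> //; [move: h0; rewrite e lee_fin|have := Ud i; rewrite e lee_fin].
have /choice[B hB] : forall i, exists B : set (k.-tuple mR), [/\ measurable B,
    (forall x, U i (F x) -> B x) &
    (mu B <= (2 ^+ k)%:E * hausdorff_gauge s (U i))%E].
  move=> i; have [[c Uc]|nU] := pselect (exists c, U i (F c)); last first.
    exists set0; split=> [//|x Ux|]; first by case: nU; exists x.
    rewrite measure0 mule_ge0 // ?lee_fin ?exprn_ge0 //.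
    by rewrite /hausdorff_gauge; case: ifP => // _; exact: poweR_ge0.
  have [de d0 d1] := dE i _ Uc; have [B [mB cB muB]] := cube_measure_box c d0.
  exists B; split=> // [x Ux|].
    apply: cB => l; apply: le_trans (Flip _ _ _) _.
    by rewrite -lee_fin -de; exact: diam_ge.
  apply: le_trans muB _; rewrite /hausdorff_gauge.
  have /negPf -> : U i != set0 by apply/eqP => /seteqP[/(_ _ Uc)].
  rewrite de poweR_EFin -EFinM lee_fin exprMn ler_pM2l ?exprn_gt0 //.
  (* Pieces of diameter 0 are treated apart: there [d ^ k = 0], because [k > 0]. *)
  rewrite -powR_mulrn //; have [<-|dn] := eqVneq 0 (d i).
    by rewrite powR0 ?powR_ge0 // pnatr_eq0 -lt0n.
  by apply: ger_powR; rewrite ?lt_neqAle ?dn ?d0 ?d1 // ltW.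
have muS : (mu S <= \sum_(i <oo) mu (B i))%E.
  apply: measure_sigma_subadditive => // [i|x Sx]; first by case: (hB i).
  by have [i _ Ui] := AU _ (SA _ Sx); exists i => //; case: (hB i) => _ + _; apply.
have : (\sum_(i <oo) mu (B i) <= (2 ^+ k)%:E * \sum_(i <oo) hausdorff_gauge s (U i))%E.
  rewrite -nneseriesZl; last first.
    move=> i _; rewrite /hausdorff_gauge; case: ifP => // _; exact: poweR_ge0.
  by apply: lee_nneseries => i _ //; case: (hB i).
move=> h; have := le_trans muS h; apply/negP; rewrite -ltNge.
have -> : mu S = (2 ^+ k * eps)%:E.
  by rewrite /eps mulrC divfK ?fineK // expf_neq0.
by rewrite EFinM lte_pmul2l // lte_fin exprn_gt0.
Qed.
End HausdorffLowerBound.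

(** * Transference between a matrix and its transpose *)

Lemma truncn_eq_dist (R : realType) (x y : R) : 0 <= x -> 0 <= y ->
  Num.truncn x = Num.truncn y -> `|x - y| < 1.
Proof.
move=> x0 y0 e; have := Num.Theory.truncn_itv x0; have := Num.Theory.truncn_itv y0.
rewrite e => /andP[a b] /andP[c d]; rewrite -natr1 in b d.
by rewrite ltr_norml; lra.
Qed.

Section Pigeonhole.
Context {R : realType} (m n : nat).
Variables (W : 'M[R]_(m, n)) (L M K : nat) (u : 'cV[int]_m) (d : 'cV[int]_n).
Variables (s : 'I_m) (delta : R).
Hypotheses (us : u s 0 != 0) (umax : forall i, `|u i 0| <= `|u s 0|).
Hypothesis delta0 : 0 < delta.
Hypothesis dual : forall j, `|(W^T *m int_vec u + int_vec d) j 0| <= delta.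
Hypotheses (K0 : (0 < K)%N) (nL0 : (0 < n * L)%N).
Hypothesis many : (M.+1 ^ m.-1 * absz (u s 0%R) * K.+1 < L.+1 ^ n)%N.

Let Th : R := (n * L)%:R * delta.
Let box := {ffun 'I_n -> 'I_L.+1}.
Let pt (x : box) : 'cV[int]_n := \col_j (x j : nat)%:Z.
Let wv (x : box) i : R := (W *m int_vec (pt x)) i 0.
Let fl (x : box) i : int := Num.floor (wv x i).
Let fr (x : box) i : R := wv x i - (fl x i)%:~R.
Let pp (x : box) : int := - (\sum_j d j 0 * (x j : nat)%:Z) - \sum_i u i 0 * fl x i.
Let th (x : box) : R := \sum_j (W^T *m int_vec u + int_vec d) j 0 * (x j)%:R.

Let Th0 : 0 < Th. Proof. by rewrite mulr_gt0 // ltr0n. Qed.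

Let fr_itv (x : box) i : 0 <= fr x i < 1.
Proof.
have := Num.Theory.floor_itv (wv x i).
by rewrite /fr /fl intrD1 => /andP[]; lra.
Qed.

Let th_bound x : `|th x| <= Th.
Proof.
apply: le_trans (ler_norm_sum _ _ _) _.
apply: (@le_trans _ _ (\sum_(j < n) delta * L%:R)).
  apply: ler_sum => j _; rewrite normrM ler_pM //.
  by rewrite ger0_norm // ler_nat -ltnS.
by rewrite sumr_const card_ord -[_ *+ n]mulr_natl /Th natrM [delta * _]mulrC mulrA.
Qed.

(** Since [u] nearly annihilates [W] modulo 1, the pairing of [u] with the fractional parts of [W x]
    is an integer [pp x] up to [th x], which is at most [Th]. So these fractional parts cluster
    around parallel hyperplanes. *)
Let dual_identity x : \sum_i (u i 0)%:~R * fr x i = th x + (pp x)%:~R.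
Proof.
rewrite /th /pp rmorphB rmorphN /= !rmorph_sum /=.
under eq_bigr => i _ do rewrite /fr mulrBr -rmorphM /=.
rewrite sumrB addrA; congr (_ - _).
under [in RHS]eq_bigr => j _ do rewrite mulmx_int_vecE mulrDl.
rewrite big_split /= -addrA.
have -> : \sum_j (d j 0)%:~R * (x j)%:R = \sum_j (d j 0 * (x j : nat)%:Z)%:~R :> R.
  by apply: eq_bigr => j _; rewrite rmorphM.
rewrite subrr addr0.
under eq_bigr => i _ do rewrite /wv mxE mulr_sumr.
rewrite exchange_big; apply: eq_bigr => j _ /=.
rewrite mulr_suml; apply: eq_bigr => i _; rewrite !mxE /=.
by rewrite mulrCA mulrA.
Qed.

Let mod_lt (x : box) : (absz (pp x %% u s 0%R)%Z < absz (u s 0%R))%N.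
Proof.
by have := ltz_mod (pp x) us; have := modz_ge0 (pp x) us; lia.
Qed.

Let key (x : box) : {ffun {i : 'I_m | i != s} -> 'I_M.+1} *
    'I_(absz (u s 0%R)) * 'I_K.+1 :=
  ([ffun i => inord (Num.truncn (M.+1%:R * fr x (val i)))],
   Ordinal (mod_lt x), inord (Num.truncn ((th x + Th) * K%:R / (2 * Th)))).

(** The key of [x] records the cells of the fractional parts outside row [s], the integer [pp x]
    modulo [u s], and the cell of [th x]. By [many] two points of the box share a key, and their
    difference settles the rows other than [s]. In row [s], [dual_identity] expresses [u s] times
    the error through the differences already known to be small, and the maximality of [u s] makes
    the division by it harmless. Reduction modulo [u s] suffices, because a multiple [k * u s] is
    absorbed by the integer [k] in row [s]. *)
Lemma dual_pigeonhole (eta : R) :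
  m%:R / M.+1%:R + 2 * Th / (K%:R * `|(u s 0)%:~R|) <= eta ->
  solvable_at W L%:R eta.
Proof.
move=> heta.
have [x [x' [xx' kxx']]] : exists x x' : box, x != x' /\ key x = key x'.
  apply: contrapT => h; suff /leq_card : injective key.
    rewrite !card_prod !card_ffun card_sig !card_ord.
    have -> : #|[pred i : 'I_m | i != s]| = m.-1.
      by have := cardC1 s; rewrite card_ord.
    by rewrite leqNgt many.
  move=> x x' e; apply/eqP; rewrite -[_ == _]negbK; apply/negP => ne.
  by apply: h; exists x, x'.
have /ffunP kf := congr1 (fun z => z.1.1) kxx'.
have km := congr1 (fun z => val z.1.2) kxx'; have kt := congr1 snd kxx'.
have uR : 0 < `|(u s 0)%:~R| :> R by rewrite normr_gt0 intr_eq0.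
have M0 : 0 < M.+1%:R :> R by rewrite ltr0n.
have KR0 : 0 < K%:R :> R by rewrite ltr0n.
have fr_close i : i != s -> `|fr x i - fr x' i| <= M.+1%:R^-1.
  move=> is_; have := congr1 val (kf (exist _ i is_)); rewrite /key /= !ffunE /=.
  have b y : (Num.truncn (M.+1%:R * fr y i) < M.+1)%N.
    have /andP[f0 f1] := fr_itv y i.
    rewrite -(ltr_nat R); apply: le_lt_trans (_ : M.+1%:R * fr y i < _).
      by rewrite Num.Theory.truncn_le // mulr_ge0.
    by rewrite -[ltRHS]mulr1 ltr_pM2l.
  rewrite !inordK // => /truncn_eq_dist.
  rewrite !mulr_ge0 //; try by case/andP: (fr_itv x i); case/andP: (fr_itv x' i).
  move=> /(_ isT isT); rewrite -mulrBr normrM gtr0_norm // mulrC.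
  by rewrite -ltr_pdivlMr // div1r => /ltW.
have Th2 : 0 < 2 * Th by apply: mulr_gt0 => //; exact: Th0.
have th_close : `|th x - th x'| <= 2 * Th / K%:R.
  have g0 y : 0 <= (th y + Th) * K%:R / (2 * Th).
    have := th_bound y; rewrite ler_norml => /andP[a _].
    have h : 0 <= th y + Th by rewrite addrC -[leLHS](subrr Th) lerD2l.
    by apply: divr_ge0; [apply: mulr_ge0|exact: ltW].
  have b y : (Num.truncn ((th y + Th) * K%:R / (2 * Th)) < K.+1)%N.
    rewrite ltnS -(ler_nat R).
    apply: le_trans (_ : (th y + Th) * K%:R / (2 * Th) <= _).
      by rewrite Num.Theory.truncn_le.
    rewrite ler_pdivrMr // mulrC ler_pM2l //.
    have := th_bound y; rewrite ler_norml => /andP[_ a].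
    by rewrite mulr_natl mulr2n lerD2r.
  have := congr1 val kt; rewrite /key /= !inordK // => /(truncn_eq_dist (g0 _) (g0 _)).
  rewrite -mulrBl -mulrBl opprD addrACA subrr addr0 normrM [`|_^-1|]gtr0_norm ?invr_gt0 //.
  rewrite ltr_pdivrMr // mul1r normrM [`|K%:R|]gtr0_norm //.
  by rewrite -ltr_pdivlMr // => /ltW.
have [k pk] : exists k, pp x - pp x' = k * u s 0.
  move: km; rewrite /key /= => e; exists ((pp x %/ u s 0%R)%Z - (pp x' %/ u s 0%R)%Z).
  have e' : (pp x %% u s 0%R)%Z = (pp x' %% u s 0%R)%Z.
    have := modz_ge0 (pp x) us; have := modz_ge0 (pp x') us; lia.
  rewrite {1}(divz_eq (pp x) (u s 0)) {1}(divz_eq (pp x') (u s 0)) e'; ring.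
pose b := pt x - pt x'.
pose c : 'cV[int]_m := \col_i (fl x' i - fl x i - (if i == s then k else 0)).
have vE i : (W *m int_vec b + int_vec c) i 0 =
    fr x i - fr x' i - (if i == s then k else 0)%:~R.
  have -> : W *m int_vec b = W *m int_vec (pt x) - W *m int_vec (pt x').
    rewrite -mulmxBr; congr (_ *m _); apply/matrixP => j l.
    by rewrite !mxE rmorphB.
  rewrite [LHS]mxE [X in X + _ = _]mxE [X in _ + X + _ = _]mxE [X in _ + _ + X = _]mxE.
  rewrite -/(wv x i) -/(wv x' i) mxE !rmorphB /= /fr; ring.
exists b, c; split.
- apply/eqP => /matrixP b0; case/eqP: xx'; apply/ffunP => j; apply/val_inj.
  by have := b0 j 0; rewrite !mxE /=; lia.
- move=> j; rewrite !mxE /= -intr_norm.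
  have := ltn_ord (x j); have := ltn_ord (x' j); rewrite !ltnS => a a'.
  have : (`|(x j)%:Z - (x' j)%:Z| <= L%:Z)%R by lia.
  by rewrite -(ler_int R).
- move=> i; rewrite vE; apply: le_trans heta.
  have m1 : 1 <= m%:R :> R by rewrite ler1n; case: (m) s => [[]|].
  case: eqP => [->|/eqP is_]; last first.
    rewrite subr0; apply: le_trans (fr_close i is_) _.
    apply: (@le_trans _ _ (m%:R / M.+1%:R)).
      by rewrite ler_peMl // invr_ge0 ltW.
    by rewrite lerDl divr_ge0 // ?(ltW Th2) // mulr_ge0.
  rewrite -(ler_pM2l uR) -normrM.
  have -> : (u s 0)%:~R * (fr x s - fr x' s - k%:~R) = (th x - th x') -
      \sum_(i | i != s) (u i 0)%:~R * (fr x i - fr x' i) :> R.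
    have E := dual_identity x; have E' := dual_identity x'.
    rewrite (bigD1 s) //= in E; rewrite (bigD1 s) //= in E'.
    have pkR : (pp x)%:~R - (pp x')%:~R = k%:~R * (u s 0)%:~R :> R.
      by rewrite -rmorphB pk rmorphM.
    under eq_bigr => j _ do rewrite mulrBr.
    rewrite sumrB; move: E E' pkR.
    set S := \sum_(_ | _) _; set S' := \sum_(_ | _) _; lra.
  apply: le_trans (ler_normB _ _) _; rewrite mulrDr addrC; apply: lerD; last first.
    apply: le_trans th_close _; rewrite le_eqVlt; apply/orP; left; apply/eqP.
    by field; rewrite !gt_eqF.
  apply: le_trans (ler_norm_sum _ _ _) _.
  apply: (@le_trans _ _ (\sum_(i < m) `|(u s 0)%:~R| / M.+1%:R)).
    rewrite [leRHS](bigD1 s) //= -[leLHS]add0r lerD ?divr_ge0 //.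
    apply: ler_sum => j js; rewrite normrM ler_pM // ?fr_close //.
    by rewrite -!intr_norm ler_int.
  by rewrite sumr_const card_ord -[_ *+ m]mulr_natl mulrCA.
Qed.
End Pigeonhole.

Lemma powR_natdivK (R : realType) m n (x : R) : (0 < m)%N -> (0 < n)%N -> 0 <= x ->
  (x `^ (n%:R / m%:R)) `^ (m%:R / n%:R) = x.
Proof.
move=> m0 n0 x0; rewrite -powRrM (_ : _ * _ = 1) ?powRr1 //.
by field; rewrite !pnatr_eq0 -!lt0n m0 n0.
Qed.

(** The dual solution confines the fractional parts of [W x] to few cells of side about [X] to the
    power [- (n / m)], fewer than there are points in the box. The constants depend on neither [W]
    nor [X], so one choice serves all scales and a whole family of matrices. *)
Lemma transference (R : realType) m n (e : R) : (0 < m)%N -> (0 < n)%N ->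
  0 < e -> e <= 1 -> exists eps kappa : R, [/\ 0 < eps, 0 < kappa &
    forall (W : 'M[R]_(m, n)) (X : R), 1 <= X -> let T := kappa * X `^ (n%:R / m%:R) in
    solvable_at W^T T (eps * T `^ (- (m%:R / n%:R))) ->
    solvable_at W X (e * X `^ (- (n%:R / m%:R)))].
Proof.
move=> m0 n0 e0 e1; have mR : 0 < m%:R :> R by rewrite ltr0n.
have nR : 0 < n%:R :> R by rewrite ltr0n.
have m1 : 1 <= m%:R :> R by rewrite ler1n.
(* The number of cells will be at most [C * (4 * n * eps2 + 2 * kappa) * X ^+ n]; [kappa] and [eps2]
   are chosen so that the two terms contribute 1/2 each, which leaves [X ^+ n], less than the number
   of points. *)
pose C : R := (3 * m%:R) ^+ m.-1 * (e ^+ m)^-1.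
have C0 : 0 < C by rewrite mulr_gt0 ?invr_gt0 ?exprn_gt0 // mulr_gt0.
pose kappa : R := (4 * C)^-1; pose eps2 : R := (8 * n%:R * C)^-1.
have k0 : 0 < kappa by rewrite invr_gt0 mulr_gt0.
have eps20 : 0 < eps2 by rewrite invr_gt0 mulr_gt0 // mulr_gt0.
exists (eps2 * kappa `^ (m%:R / n%:R)), kappa; split=> //.
  by rewrite mulr_gt0 ?powR_gt0.
move=> W X X1 T; have X0 : 0 < X by apply: lt_le_trans X1.
have Xw0 : 0 < X `^ (n%:R / m%:R) by rewrite powR_gt0.
have -> : eps2 * kappa `^ (m%:R / n%:R) * T `^ (- (m%:R / n%:R)) = eps2 / X.
  rewrite -mulrA powRN /T powRM ?(ltW k0) ?(ltW Xw0) // powR_natdivK ?(ltW X0) //.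
  congr (_ * _); rewrite invfM mulrA mulfV ?mul1r // gt_eqF // powR_gt0 //.
move=> [u [d [u0 uT dual]]].
pose i0 : 'I_m := Ordinal m0.
have [s smax] : exists s, forall i, (absz (u i 0%R) <= absz (u s 0%R))%N.
  by have [s _ h] := arg_maxnP (fun i => absz (u i 0)) (isT : xpredT i0);
    exists s => i; exact: h.
have umax i : `|u i 0| <= `|u s 0| by rewrite -!abszE lez_nat; exact: smax.
have us : u s 0 != 0.
  apply/eqP => us0; case/eqP: u0; apply/matrixP => i j; rewrite ord1 mxE.
  by apply/eqP; rewrite -normr_le0; have := umax i; rewrite us0 normr0.
pose U : R := `|(u s 0)%:~R|.
have U1 : 1 <= U by rewrite /U -intr_norm -[1]/(1%:~R) ler_int -gtz0_ge1 normr_gt0.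
have U0 : 0 < U by apply: lt_le_trans U1.
have UT : U <= T by exact: uT.
pose H : R := e * X `^ (- (n%:R / m%:R)).
have H0 : 0 < H by rewrite mulr_gt0 ?powR_gt0.
have H1 : H <= 1.
  rewrite /H powRN; apply: mulr_ile1 => //; rewrite ?invr_ge0 ?(ltW Xw0) ?(ltW e0) //.
  rewrite invf_le1 //; apply: (@le_trans _ _ (X `^ 0)); first by rewrite powRr0.
  by apply: ler_powR => //; rewrite divr_ge0.
have TH : T * H = kappa * e.
  by rewrite /T /H powRN; field; rewrite gt_eqF.
have HX : (H ^+ m)^-1 = (e ^+ m)^-1 * X ^+ n.
  rewrite /H exprMn invfM powRN exprVn invrK; congr (_ * _).
  rewrite -[LHS]powR_mulrn ?(ltW Xw0) // -powRrM divfK ?gt_eqF //.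
  by rewrite powR_mulrn // ltW.
pose L := Num.truncn X.
have /andP[LX XL] : L%:R <= X < L.+1%:R by exact: Num.Theory.truncn_itv (ltW X0).
have L0 : (0 < L)%N.
  by rewrite -ltnS -(ltr_nat R); apply: le_lt_trans X1 XL.
have delta0 : 0 < eps2 / X by rewrite divr_gt0.
pose Th : R := (n * L)%:R * (eps2 / X).
have Th0 : 0 < Th by rewrite mulr_gt0 // ltr0n muln_gt0 n0.
have ThE : Th <= n%:R * eps2.
  rewrite /Th natrM -mulrA ler_pM2l // mulrCA ler_piMr ?(ltW eps20) //.
  by rewrite ler_pdivrMr // mul1r.
(* [M] and, below, [K] make each of the two error terms of [dual_pigeonhole] at most [H / 2]. *)
pose M := Num.truncn (2 * m%:R / H).
have MH0 : 0 <= 2 * m%:R / H by rewrite divr_ge0 ?(ltW H0) // mulr_ge0.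
have /andP[M1 M2] : M%:R <= 2 * m%:R / H < M.+1%:R.
  exact: Num.Theory.truncn_itv.
pose K := (Num.truncn (4 * Th / (U * H))).+1.
have KH0 : 0 <= 4 * Th / (U * H).
  by rewrite divr_ge0 // mulr_ge0 // ltW.
have /andP[K1 K2] : (K.-1)%:R <= 4 * Th / (U * H) < K%:R.
  exact: Num.Theory.truncn_itv.
have K0 : 0 < K%:R :> R by rewrite ltr0n.
apply: (@solvable_at_le _ _ _ W L%:R _ H) => //.
apply: (@dual_pigeonhole _ _ _ W L M K u d s (eps2 / X)) => //.
- by rewrite muln_gt0 n0.
- rewrite -(ltr_nat R) !natrM !natrX natr_absz intr_norm -/U.
  have hM : M.+1%:R <= 3 * m%:R / H.
    have mH : 1 <= m%:R / H by rewrite ler_pdivlMr // mul1r (le_trans H1).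
    by rewrite -natr1; move: M1 mH; rewrite -!mulrA; lra.
  have hK : U * K.+1%:R <= (4 * n%:R * eps2 + 2 * kappa) / H.
    rewrite -[K.+1]addn1 natrD -[K]prednK // -addn1 natrD.
    have h1 : U * (K.-1)%:R <= 4 * (n%:R * eps2) / H.
      apply: (@le_trans _ _ (U * (4 * Th / (U * H)))); first by rewrite ler_pM2l.
      have -> : U * (4 * Th / (U * H)) = 4 * Th / H by field; rewrite !gt_eqF.
      by rewrite ler_pM2r ?invr_gt0 // ler_pM2l.
    have h2 : U <= kappa / H.
      rewrite ler_pdivlMr //; apply: (@le_trans _ _ (T * H)).
        by rewrite ler_pM2r.
      by rewrite TH ler_piMr // ltW.
    rewrite !mulrDr !mulrDl mulr1 -!mulrA; move: h1 h2; rewrite -!mulrA; lra.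
  apply: (@le_lt_trans _ _ (X ^+ n)); last first.
    by rewrite ltrXn2r -?lt0n // ?ltW.
  rewrite -mulrA; apply: (@le_trans _ _
      ((3 * m%:R / H) ^+ m.-1 * ((4 * n%:R * eps2 + 2 * kappa) / H))).
    apply: ler_pM => //; rewrite ?exprn_ge0 ?mulr_ge0 ?(ltW U0) //.
    by rewrite lerXn2r ?nnegrE // ltW // (lt_le_trans _ hM).
  have -> : (3 * m%:R / H) ^+ m.-1 * ((4 * n%:R * eps2 + 2 * kappa) / H) =
      (3 * m%:R) ^+ m.-1 * (4 * n%:R * eps2 + 2 * kappa) * (H ^+ m)^-1.
    have -> : (H ^+ m)^-1 = (H ^+ m.-1)^-1 * H^-1.
      by rewrite -invfM -exprSr prednK.
    by rewrite exprMn exprVn; ring.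
  rewrite HX.
  have -> : (3 * m%:R) ^+ m.-1 * (4 * n%:R * eps2 + 2 * kappa) *
      ((e ^+ m)^-1 * X ^+ n) = C * (4 * n%:R * eps2 + 2 * kappa) * X ^+ n.
    by rewrite /C; ring.
  have -> : C * (4 * n%:R * eps2 + 2 * kappa) = 1.
    by rewrite /eps2 /kappa; field; rewrite !gt_eqF.
  by rewrite mul1r.
- have h1 : m%:R / M.+1%:R <= H / 2.
    rewrite ler_pdivrMr ?ltr0n // mulrAC ler_pdivlMr // mulrC [H * _]mulrC.
    by rewrite -ler_pdivrMr // ltW.
  have h2 : 2 * Th / (K%:R * U) <= H / 2.
    rewrite ler_pdivrMr ?mulr_gt0 //.
    have -> : H / 2 * (K%:R * U) = K%:R * (U * H) / 2 by ring.
    move/ltW: K2; rewrite ler_pdivrMr ?(mulr_gt0 U0 H0) //.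
    by move: (K%:R * (U * H)) (Th) => q th; lra.
  by rewrite [leRHS](splitr H) lerD.
Qed.

Lemma powR_natdiv_ge (R : realType) (w k t0 : R) : 0 < w -> 0 < k ->
  \forall X \near +oo, t0 <= k * X `^ w.
Proof.
move=> w0 k0; pose y := Num.max 1 (t0 / k).
exists (y `^ w^-1); split; first exact: num_real.
move=> X /ltW yX; have y0 : 0 <= y by rewrite le_max ler01.
rewrite mulrC -ler_pdivrMr //; apply: (@le_trans _ _ y).
  by rewrite le_max lexx orbT.
rewrite -[leLHS]powRr1 // -[Z in y `^ Z](mulVf (lt0r_neq0 w0)) powRrM.
by apply: ge0_ler_powR; rewrite ?nnegrE ?powR_ge0 ?(ltW w0) // (le_trans _ yX) ?powR_ge0.
Qed.

Section TransposeProperties.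
Context {R : realType} (m n : nat).
Hypotheses (m0 : (0 < m)%N) (n0 : (0 < n)%N).
Variable W : 'M[R]_(m, n).
Let w : R := n%:R / m%:R.
Let w' : R := m%:R / n%:R.

Let w0 : 0 < w. Proof. by rewrite divr_gt0 // ltr0n. Qed.
Let w'0 : 0 < w'. Proof. by rewrite divr_gt0 // ltr0n. Qed.

Lemma often_well_solvable_trmx : often_well_solvable w' W^T -> often_well_solvable w W.
Proof.
move=> h e t0 e0; pose e1 := Num.min e 1.
have e10 : 0 < e1 by rewrite lt_min e0 ltr01.
have e11 : e1 <= 1 by rewrite ge_min lexx orbT.
have [eps [kappa [eps0 k0 tr]]] := @transference R m n e1 m0 n0 e10 e11.
pose X0 := Num.max 1 t0.
have [T T0 sT] := h eps (kappa * X0 `^ w) eps0.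
have X00 : 0 < X0 by rewrite lt_max ltr01.
(* This [X] solves [kappa * X ^ w = T]. *)
pose X := (T / kappa) `^ w'.
have Tk : X0 `^ w <= T / kappa by rewrite ler_pdivlMr // mulrC.
have Tk0 : 0 <= T / kappa by apply: le_trans Tk; rewrite powR_ge0.
have XX : X0 <= X.
  rewrite -[X0](powR_natdivK m0 n0 (ltW X00)) -/w -/w'.
  by apply: ge0_ler_powR; rewrite ?nnegrE ?powR_ge0 ?(ltW w'0).
have X1 : 1 <= X by apply: le_trans XX; rewrite le_max lexx.
exists X; first by apply: le_trans XX; rewrite le_max lexx orbT.
have TE : kappa * X `^ w = T.
  by rewrite /X powR_natdivK // mulrC divfK // gt_eqF.
have := tr W X X1; rewrite /= -/w -/w' TE => /(_ sT).
apply: solvable_at_le => //; have X0' := lt_le_trans ltr01 X1.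
by rewrite (ler_pM2r (powR_gt0 _ X0')) ge_min lexx.
Qed.

(** The contrapositive of [transference]: if [W] is unsolvable at [X], then its transpose is
    unsolvable at [kappa * X ^ w], which tends to infinity with [X]. *)
Lemma often_unsolvable_trmx c : 0 < c -> often_unsolvable w W c ->
  exists2 c', 0 < c' & often_unsolvable w' W^T c'.
Proof.
move=> c0 h; pose e1 := Num.min c 1.
have e10 : 0 < e1 by rewrite lt_min c0 ltr01.
have e11 : e1 <= 1 by rewrite ge_min lexx orbT.
have [eps [kappa [eps0 k0 tr]]] := @transference R m n e1 m0 n0 e10 e11.
exists eps => // t0; have [y [_ hy]] := @powR_natdiv_ge R w kappa t0 w0 k0.
have [X Xy nX] := h (Num.max 1 (y + 1)).
have X1 : 1 <= X by apply: le_trans Xy; rewrite le_max lexx.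
exists (kappa * X `^ w).
  by apply: hy; apply: lt_le_trans Xy; rewrite lt_max ltrDl ltr01 orbT.
move=> /(tr W X X1) sX; apply: nX; apply: solvable_at_le sX => //.
have X0 := lt_le_trans ltr01 X1.
by rewrite (ler_pM2r (powR_gt0 _ X0)) ge_min lexx.
Qed.

End TransposeProperties.

(** [eps] precedes [W] because [exists_family] constructs the matrices only once [eps] is known. *)
Lemma uniformly_solvable_trmx (R : realType) m n (e : R) : (0 < m)%N -> (0 < n)%N ->
  0 < e -> exists2 eps, 0 < eps & forall W : 'M[R]_(m, n),
    uniformly_solvable (m%:R / n%:R) W^T eps -> uniformly_solvable (n%:R / m%:R) W e.
Proof.
move=> m0 n0 e0; pose e1 := Num.min e 1.
have e10 : 0 < e1 by rewrite lt_min e0 ltr01.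
have e11 : e1 <= 1 by rewrite ge_min lexx orbT.
have [eps [kappa [eps0 k0 tr]]] := @transference R m n e1 m0 n0 e10 e11.
exists eps => // W [t0 [_ ht0]].
have w0 : 0 < n%:R / m%:R :> R by rewrite divr_gt0 // ltr0n.
have [y [_ hy]] := @powR_natdiv_ge R _ kappa (t0 + 1) w0 k0.
exists (Num.max 1 y); split; first exact: num_real.
move=> X; rewrite gt_max => /andP[X1 Xy].
have sX := tr W X (ltW X1) (ht0 _ (lt_le_trans _ (hy _ Xy))).
apply: solvable_at_le (sX _) => //; last by rewrite ltrDl ltr01.
by rewrite (ler_pM2r (powR_gt0 _ (lt_trans ltr01 X1))) ge_min lexx.
Qed.

(** * Random extensions of the block *)

Definition near_int (R : realType) (eta : R) : set R :=
  [set y | exists q : int, `|y + q%:~R| <= eta].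

Lemma near_intN (R : realType) (eta y : R) : near_int eta (- y) -> near_int eta y.
Proof.
by move=> [q hq]; exists (- q); rewrite rmorphN /= -normrN opprB addrC.
Qed.

Lemma measurable_near_int (R : realType) (eta : R) :
  measurable (near_int eta : set (measurableTypeR R)).
Proof.
have -> : near_int eta = \bigcup_(q : int) [set` `[- eta - q%:~R, eta - q%:~R]].
  apply/seteqP; split=> [y [q]|y [q _]].
    by rewrite ler_norml => h; exists q => //=; rewrite in_itv /=; lra.
  by rewrite /= in_itv /= => h; exists q; rewrite ler_norml; lra.
by apply: countable_bigcupT_measurable => // q; exact: measurable_itv.
Qed.

(* The at most b + 2 relevant integers each contribute an interval of length
   2 eta / b, and (b + 2) / b <= 3. *)
Lemma unit_uniform_near_int (R : realType) (eta z : R) (b : int) :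
  0 <= eta -> b != 0 ->
  (unit_uniform [set x : measurableTypeR R | near_int eta (z + b%:~R * x)%R]
    <= (6 * eta)%:E)%E.
Proof.
wlog b0 : z b / 0 < b => [wl|] eta0 bn.
  have [b0|b0|b0] := ltgtP 0 b; first exact: wl.
    have := @wl (- z) (- b); rewrite oppr_gt0 oppr_eq0 => /(_ b0 eta0 bn).
    congr (unit_uniform _ <= _)%E; apply/seteqP.
    have e x : - z + (- b)%:~R * x = - (z + b%:~R * x) by rewrite rmorphN /=; ring.
    by split=> x /=; rewrite e => h; apply: near_intN => //; rewrite opprK.
  by rewrite -b0 eqxx in bn.
set S := [set x | _].
have mS : measurable S.
  rewrite /S -[X in measurable X]setTI.
  apply: (_ : measurable_fun setT _) => //; last exact: measurable_near_int.
  apply: measurable_funD; first exact: measurable_cst.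
  by apply: measurable_funM; first exact: measurable_cst.
have [eta2|eta2] := leP (6 * eta) 1; last first.
  by apply: le_trans (probability_le1 _ mS) _; rewrite lee_fin ltW.
have [n nb] : exists n : nat, b = n%:Z by exists `|b|%N; rewrite gtz0_abs.
have n0 : (0 < n)%N by move: b0; rewrite nb.
have nR : 0 < n%:R :> R by rewrite ltr0n.
pose q0 := Num.floor (eta - z).
have := Num.Theory.floor_itv (eta - z); rewrite -/q0 intrD1 => /andP[q0l q0r].
pose I (r : nat) : set R :=
  [set` `[(- eta - z - (q0 - r%:Z)%:~R) / n%:R, (eta - z - (q0 - r%:Z)%:~R) / n%:R]].
have SI : S `&` `[0, 1] `<=` \big[setU/set0]_(r < n.+2) I r.
  move=> x [[q hq] /=]; rewrite in_itv /= => /andP[x0 x1].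
  move: hq; rewrite nb ler_norml => /andP[h1 h2].
  have nx0 : 0 <= n%:R * x by rewrite mulr_ge0.
  have nx1 : n%:R * x <= n%:R by rewrite ler_piMr.
  have qq0 : q <= q0.
    by rewrite /q0 Num.Theory.floor_ge_int; rewrite -pmulrn in h2; lra.
  pose r := `|q0 - q|%N; have rE : r%:Z = q0 - q by rewrite /r gez0_abs ?subr_ge0.
  have rR : r%:R = q0%:~R - q%:~R :> R by rewrite -rmorphB -rE.
  have rn : (r < n.+2)%N.
    rewrite -(ltr_nat R) -2!natr1 rR; rewrite -pmulrn in h1; lra.
  rewrite -bigcup_mkord; exists r => //=; rewrite /I /= in_itv /= rE.
  rewrite ler_pdivrMr // ler_pdivlMr // subKr.
  by rewrite -pmulrn in h1 h2; lra.
apply: (@le_trans _ _ (\sum_(r < n.+2) (2 * eta / n%:R)%:E)%E).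
  apply: (@le_trans _ _ (\sum_(r < n.+2) lebesgue_measure (I r))%E); last first.
    apply: lee_sum => r _; rewrite lebesgue_measure_itv /=; case: ifP => h.
      by rewrite EFinN -EFinB lee_fin -mulrBl ler_pM2r ?invr_gt0 //; lra.
    by rewrite lee_fin divr_ge0 // mulr_ge0.
  have mI : forall r : nat, (r < n.+2)%N -> measurable (I r).
    by move=> r _; exact: measurable_itv.
  apply: (le_trans _ (Boole_inequality lebesgue_measure mI)).
  apply: le_measure; rewrite ?inE //.
    by apply: measurableI => //; exact: measurable_itv.
  by apply: bigsetU_measurable => r _; exact: measurable_itv.
rewrite sumEFin lee_fin sumr_const card_ord -[_ *+ n.+2]mulr_natl.
rewrite mulrA ler_pdivrMr // -2!natr1.
by have : 1 <= n%:R :> R; [rewrite ler1n|nra].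
Qed.

Section Extension.
Context {R : realType} (m p : nat).
Notation mR := (measurableTypeR R).

Fact entry_pos_subproof (i : 'I_m) (j : 'I_p) : (i * p + j < m * p)%N.
Proof.
have := ltn_ord i; have := ltn_ord j => jp im.
by apply: (@leq_trans (i.+1 * p)); [rewrite mulSn addnC ltn_add2r|rewrite leq_mul2r im orbT].
Qed.
(** Row-major order: inside a row the positions follow the columns, which makes the conditions of
    [cube_measure_solution] triangular. *)
Definition entry_pos (i : 'I_m) (j : 'I_p) : 'I_(m * p) :=
  Ordinal (entry_pos_subproof i j).

Fact pos_row_subproof (l : 'I_(m * p)) : (l %/ p < m)%N.
Proof.
case: p l => [|q] l; first by case: l => l; rewrite muln0.
by rewrite ltn_divLR.
Qed.
Definition pos_row l : 'I_m := Ordinal (pos_row_subproof l).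

Fact pos_col_subproof (l : 'I_(m * p)) : (l %% p < p)%N.
Proof.
case: p l => [|q] l; first by case: l => l; rewrite muln0.
by rewrite ltn_mod.
Qed.
Definition pos_col l : 'I_p := Ordinal (pos_col_subproof l).

Lemma entry_posK l : entry_pos (pos_row l) (pos_col l) = l.
Proof. by apply/val_inj; rewrite /= -divn_eq. Qed.

Lemma pos_rowK i j : pos_row (entry_pos i j) = i.
Proof.
by apply/val_inj => /=; rewrite divnMDl ?(leq_ltn_trans _ (ltn_ord j)) // divn_small ?addn0.
Qed.

Lemma pos_colK i j : pos_col (entry_pos i j) = j.
Proof. by apply/val_inj => /=; rewrite modnMDl modn_small. Qed.

Lemma sum_entry_pos (F : 'I_(m * p) -> R) :
  \sum_l F l = \sum_i \sum_j F (entry_pos i j).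
Proof.
rewrite pair_big /= (reindex (fun ij : 'I_m * 'I_p => entry_pos ij.1 ij.2)) //=.
exists (fun l => (pos_row l, pos_col l)) => [[i j] _|l _] /=.
  by rewrite pos_rowK pos_colK.
exact: entry_posK.
Qed.

Definition tuple_mx (t : (m * p).-tuple mR) : 'M[R]_(m, p) :=
  \matrix_(i, j) tnth t (entry_pos i j).

Definition extension (A : 'M[R]_(m, 2)) (B0 : 'M[R]_(m, p)) t : 'M[R]_(m, 2 + p) :=
  row_mx A (B0 + tuple_mx t).

Lemma extension_entry_dist A B0 t t' l :
  `|tnth t l - tnth t' l| <= `|extension A B0 t - extension A B0 t'|.
Proof.
have -> : tnth t l - tnth t' l =
    (extension A B0 t - extension A B0 t') (pos_row l) (rshift 2 (pos_col l)).
  rewrite /extension !mxE !(unsplitK (inr _ : 'I_2 + 'I_p)) !mxE entry_posK.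
  ring.
rewrite [leRHS]mx_normrE.
exact: (le_bigmax _ (fun ij => `|(extension A B0 t - extension A B0 t') ij.1 ij.2|)
  (pos_row l, rshift 2 (pos_col l))).
Qed.

Lemma solvable_at_row_mx (A : 'M[R]_(m, 2)) (B : 'M[R]_(m, p)) t c :
  0 <= t -> solvable_at A t c -> solvable_at (row_mx A B) t c.
Proof.
move=> t0 [b [d [b0 bt bc]]]; exists (col_mx b 0), d; split.
- by rewrite col_mx_eq0 (negPf b0).
- move=> j; rewrite mxE; case: splitP => k _; first exact: bt.
  by rewrite mxE normr0.
- move=> i; rewrite (_ : _ *m int_vec _ = A *m int_vec b) //.
  by rewrite /int_vec map_col_mx map_mx0 mul_row_col mulmx0 addr0.
Qed.

Lemma solvable_row_mx_split (A : 'M[R]_(m, 2)) (B : 'M[R]_(m, p)) t c :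
  solvable_at (row_mx A B) t c -> solvable_at A t c \/
  exists b : 'cV[int]_(2 + p), exists d : 'cV[int]_m,
    [/\ dsubmx b != 0, forall j, `|(b j 0)%:~R| <= t &
        forall i, `|(row_mx A B *m int_vec b + int_vec d) i 0| <= c].
Proof.
move=> [b [d [b0 bt bc]]]; have [bd|bd] := eqVneq (dsubmx b) 0; last first.
  by right; exists b, d; split.
left; exists (usubmx b), d; split.
- by apply: contraNneq b0 => bu; rewrite -[b]vsubmxK bu bd col_mx0.
- by move=> j; rewrite mxE; exact: bt.
- move=> i; rewrite (_ : A *m _ = row_mx A B *m int_vec b) //.
  rewrite -[in RHS](vsubmxK b) bd /int_vec map_col_mx map_mx0 mul_row_col.
  by rewrite mulmx0 addr0.
Qed.

Lemma nonzero_first (V : zmodType) (q : nat) (b : 'cV[V]_q) : b != 0 ->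
  exists j0, b j0 0 != 0 /\ forall j : 'I_q, (j < j0)%N -> b j 0 = 0.
Proof.
move=> b0; have /existsP[j1 hj1] : [exists j, b j 0 != 0].
  rewrite -[X in is_true X]negbK; apply/negP => /existsPn h; case/eqP: b0.
  by apply/matrixP => i j; rewrite ord1 mxE; apply/eqP; rewrite -[_ == _]negbK; exact: h.
have [j0 h jmin] := @arg_minnP 'I_q j1 (fun j => b j 0 != 0) val hj1.
exists j0; split=> // j jj0; apply/eqP; rewrite -[_ == _]negbK; apply/negP => /jmin.
by rewrite leqNgt jj0.
Qed.

(* A solution whose last p coordinates are not all 0 confines, in each row, the
   entry facing the first nonzero one of them to an interval modulo 1. *)
Lemma cube_measure_solution (A : 'M[R]_(m, 2)) (B0 : 'M[R]_(m, p))
    (b : 'cV[int]_(2 + p)) (eta : R) : 0 <= eta -> dsubmx b != 0 ->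
  exists E : set ((m * p).-tuple mR), [/\ measurable E,
    (forall t (d : 'cV[int]_m),
      (forall i, `|(extension A B0 t *m int_vec b + int_vec d) i 0| <= eta) -> E t) &
    (cube_measure (m * p) E <= ((6 * eta) ^+ m)%:E)%E].
Proof.
move=> eta0 /nonzero_first[j0 [bj0 bmin]].
pose y l : R := (row_mx A B0 *m int_vec b) (pos_row l) 0.
pose c (l l' : 'I_(m * p)) : R :=
  if pos_row l' == pos_row l then (dsubmx b (pos_col l') 0)%:~R else 0.
pose J : pred 'I_(m * p) := fun l => pos_col l == j0.
exists (linear_cylinder J y c (fun=> near_int eta)); split.
- by apply: measurable_linear_cylinder => l; exact: measurable_near_int.
- move=> t d h l Jl; exists (d (pos_row l) 0).
  have := h (pos_row l); congr (`|_| <= _).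
  rewrite mxE [int_vec d _ _]mxE; congr (_ + _).
  rewrite /extension -[A]addr0 -add_row_mx mulmxDl mxE; congr (_ + _).
  rewrite -[in LHS](vsubmxK b) /int_vec map_col_mx mul_row_col mul0mx add0r.
  rewrite mxE sum_entry_pos (bigD1 (pos_row l)) //= [X in _ = _ + X]big1.
    rewrite addr0; apply: eq_bigr => j _.
    by rewrite /c pos_rowK eqxx pos_colK !mxE mulrC.
  move=> i il; apply: big1 => j _; rewrite /c pos_rowK (negPf il) mul0r //.
- have cJ : #|J| = m.
    have inj : injective (entry_pos^~ j0).
      by move=> i i' /(congr1 pos_row); rewrite !pos_rowK.
    rewrite -[RHS]card_ord -(card_codom inj); apply: eq_card => l.
    rewrite unfold_in /J; apply/eqP/codomP => [<-|[i ->]]; last exact: pos_colK.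
    by exists (pos_row l); rewrite entry_posK.
  rewrite -[X in (_ ^+ X)%:E]cJ.
  apply: cube_measure_linear_cylinder; first by rewrite mulr_ge0.
  + by move=> l; exact: measurable_near_int.
  + move=> l i Jl il; rewrite /c; case: eqP => // e; rewrite bmin //.
    move: il; rewrite {1}(divn_eq i p) {1}(divn_eq l p).
    by rewrite (congr1 val e : i %/ p = l %/ p)%N ltn_add2l -(eqP Jl).
  + move=> l z /eqP Jl; rewrite /c eqxx Jl.
    exact: unit_uniform_near_int.
Qed.

End Extension.

Section GoodExtensions.
Context {R : realType} (m p : nat).
Hypothesis m0 : (0 < m)%N.
Notation mR := (measurableTypeR R).
Variables (A : 'M[R]_(m, 2)) (B0 : 'M[R]_(m, p)).
Let n := (2 + p)%N.
Let w : R := n%:R / m%:R.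

(** Union bound. At most [(3 * t) ^+ n] integral vectors have coordinates bounded by [t >= 1], and
    each of those concerned is a solution with probability at most [(6 * delta) ^+ m / t ^+ n]. The
    powers of [t] cancel, so [delta] does not depend on [t]; with [6 * delta = D^-1] the total is at
    most 1/2, because [D ^+ m >= D = 2 * 3 ^+ n]. *)
Lemma exists_good_extensions : exists2 delta : R, 0 < delta & forall t, 1 <= t ->
  exists G : set ((m * p).-tuple mR), [/\ measurable G,
    (2^-1%:E <= cube_measure (m * p) G)%E &
    forall x, G x -> forall (b : 'cV[int]_n) (d : 'cV[int]_m),
      dsubmx b != 0 -> (forall j, `|(b j 0)%:~R| <= t) ->
      ~ forall i, `|(extension A B0 x *m int_vec b + int_vec d) i 0|
                    <= delta * t `^ (- w)].
Proof.
pose D : R := 2 * 3 ^+ n; have D1 : 1 <= D.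
  rewrite /D; apply: (@le_trans _ _ (2 * 1)); first by rewrite mulr1 ler1n.
  by rewrite ler_pM2l // exprn_ege1 // ler1n.
have D0 : 0 < D by apply: lt_le_trans D1.
exists (6 * D)^-1; first by rewrite invr_gt0 mulr_gt0.
move=> t t1; have t0 : 0 < t by apply: lt_le_trans t1.
set eta := _^-1 * _; have eta0 : 0 <= eta by rewrite mulr_ge0 ?powR_ge0 // invr_ge0 mulr_ge0 // ltW.
pose L := Num.truncn t.
have /andP[Lt tL] : L%:R <= t < L.+1%:R by exact: Num.Theory.truncn_itv (ltW t0).
pose vec (f : {ffun 'I_n -> 'I_(2 * L).+1}) : 'cV[int]_n := \col_j ((f j : nat)%:Z - L%:Z).
have /choice[E hE] : forall f, exists E : set ((m * p).-tuple mR), [/\ measurable E,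
    (forall x (d : 'cV[int]_m), dsubmx (vec f) != 0 ->
      (forall i, `|(extension A B0 x *m int_vec (vec f) + int_vec d) i 0| <= eta) -> E x) &
    (cube_measure (m * p) E <= ((6 * eta) ^+ m)%:E)%E].
  move=> f; have [z|nz] := eqVneq (dsubmx (vec f)) 0.
    exists set0; rewrite measure0; split=> [//|x d|]; first by rewrite ?z ?eqxx.
    by rewrite lee_fin exprn_ge0 // mulr_ge0.
  have [E [mE EE muE]] := @cube_measure_solution R m p A B0 (vec f) eta eta0 nz.
  by exists E; split=> // x d _; exact: EE.
pose EU := \bigcup_(f in [set: {ffun 'I_n -> 'I_(2 * L).+1}]) E f.
have mEU : measurable EU.
  by apply: fin_bigcup_measurable => [|f _]; [exact: finite_finset|case: (hE f)].
exists (~` EU); split; first exact: measurableC.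
- rewrite probability_setC // -[X in (X%:E <= _)%E](_ : 1 - 2^-1 = _); last by lra.
  rewrite EFinB leeB //.
  pose T := {ffun 'I_n -> 'I_(2 * L).+1}.
  pose F k := if (k < #|T|)%N =P true is ReflectT h then E (enum_val (Ordinal h)) else set0.
  have EUF : EU = \big[setU/set0]_(k < #|T|) F k.
    rewrite -bigcup_mkord; apply/seteqP; split=> x [f fT Ex].
      exists (enum_rank f : nat) => /=; first exact: ltn_ord.
      rewrite /F; case: eqP => [h|]; last by rewrite ltn_ord.
      by rewrite (_ : Ordinal h = enum_rank f) ?enum_rankK //; exact/val_inj.
    move: Ex; rewrite /F; case: eqP => [h Ex|_ []].
    by exists (enum_val (Ordinal h)).
  have mF k : measurable (F k) /\ (cube_measure (m * p) (F k) <= ((6 * eta) ^+ m)%:E)%E.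
    rewrite /F; case: eqP => [h|_]; first by case: (hE (enum_val (Ordinal h))).
    by rewrite measure0 lee_fin exprn_ge0 // mulr_ge0.
  rewrite EUF; apply: le_trans (Boole_inequality _ _) _.
    by move=> k _; case: (mF k).
  apply: (@le_trans _ _ (\sum_(k < #|T|) ((6 * eta) ^+ m)%:E)%E).
    by apply: lee_sum => k _; case: (mF k).
  rewrite sumEFin lee_fin sumr_const card_ord card_ffun !card_ord -[_ *+ _]mulr_natl.
  have -> : (6 * eta) ^+ m = (D^-1) ^+ m * (t ^+ n)^-1.
    rewrite -[t ^+ n]powR_mulrn ?(ltW t0) //.
    have -> : t `^ n%:R = (t `^ w) ^+ m.
      rewrite -powR_mulrn ?powR_ge0 // -powRrM /w divfK //.
      by rewrite pnatr_eq0 -lt0n.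
    rewrite /eta powRN -exprVn -exprMn; congr (_ ^+ _); field.
    by rewrite !gt_eqF // powR_gt0.
  have h1 : ((2 * L).+1 ^ n)%:R <= 3 ^+ n * t ^+ n :> R.
    rewrite natrX -exprMn lerXn2r ?nnegrE ?mulr_ge0 ?(ltW t0) //.
    by rewrite -natr1 natrM; lra.
  have h2 : D^-1 ^+ m <= (2 * 3 ^+ n)^-1.
    by rewrite -[m]prednK // exprS ler_piMr ?invr_ge0 ?(ltW D0) // exprn_ile1 ?invr_ge0 ?(ltW D0) // invf_le1.
  apply: (@le_trans _ _ (3 ^+ n * t ^+ n * ((2 * 3 ^+ n)^-1 * (t ^+ n)^-1))).
    apply: ler_pM => //; first by rewrite mulr_ge0 ?exprn_ge0 ?invr_ge0 ?exprn_ge0 ?(ltW D0) ?(ltW t0).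
    by rewrite ler_pM2r // invr_gt0 exprn_gt0.
  rewrite le_eqVlt; apply/orP; left; apply/eqP; field.
  by rewrite !expf_neq0 ?gt_eqF.
- move=> x nEx b d bd bt h; apply: nEx.
  have bL j : 0 <= b j 0 + L%:Z <= (2 * L)%:Z.
    have := bt j; rewrite -intr_norm => h1.
    have : `|b j 0| < L.+1%:Z by rewrite -(ltr_int R) (le_lt_trans h1).
    by rewrite ltr_norml; lia.
  pose f : {ffun 'I_n -> 'I_(2 * L).+1} := [ffun j => inord (absz (b j 0 + L%:Z))].
  have fb : vec f = b.
    apply/matrixP => j k; rewrite ord1 !mxE ffunE inordK; first by have := bL j; lia.
    by rewrite ltnS; have := bL j; lia.
  exists f => //; case: (hE f) => _ + _; rewrite fb; apply => //; exact: h.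
Qed.

(** A relation that involves the random entries confines them to a null hyperplane, and there are
    countably many rational relations; one that does not involve them is a relation for [A]. *)
Lemma Q_free_extensions : entries_and_one_Q_free A ->
  exists N : set ((m * p).-tuple mR), [/\ measurable N,
    cube_measure (m * p) N = 0 &
    forall x, ~ N x -> entries_and_one_Q_free (extension A B0 x)].
Proof.
move=> freeA.
pose c (q : 'M[rat]_(m, n)) : 'cV[R]_(m * p) :=
  \col_l ratr (q (pos_row l) (rshift 2 (pos_col l))).
pose y (q0 : rat) (q : 'M[rat]_(m, n)) : R :=
  ratr q0 + \sum_i \sum_j ratr (q i j) * row_mx A B0 i j.
pose Z (z : rat * 'M[rat]_(m, n)) : set ((m * p).-tuple mR) :=
  [set x | y z.1 z.2 + \sum_l c z.2 l 0 * tnth x l = 0].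
have relE q0 (q : 'M[rat]_(m, n)) x : ratr q0 + \sum_i \sum_j ratr (q i j) * extension A B0 x i j =
    y q0 q + \sum_l c q l 0 * tnth x l.
  rewrite /y -addrA; congr (_ + _); rewrite sum_entry_pos -big_split.
  apply: eq_bigr => i _ /=; rewrite !big_split_ord /= -addrA; congr (_ + _).
    by apply: eq_bigr => j _; rewrite !mxE !(unsplitK (inl _ : 'I_2 + 'I_p)).
  rewrite -big_split; apply: eq_bigr => j _ /=.
  by rewrite !mxE !(unsplitK (inr _ : 'I_2 + 'I_p)) !mxE pos_rowK pos_colK mulrDr.
have hZ z : c z.2 != 0 -> measurable (Z z) /\ cube_measure (m * p) (Z z) = 0.
  move=> /nonzero_first[l0 [cl0 cmin]].
  (* A single condition, placed at the first nonzero coefficient, describes the hyperplane; the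
     cylinder bound then applies with [eps = 0]. *)
  have -> : Z z = linear_cylinder (pred1 l0) (fun=> y z.1 z.2)
      (fun _ l => c z.2 l 0) (fun=> [set 0]).
    apply/seteqP; split=> [x h l _|x h]; first exact: h.
    exact: (h l0 (eqxx _)).
  have m1 : measurable ([set 0] : set mR) by exact: measurable_set1.
  split; first exact: measurable_linear_cylinder.
  apply/eqP; rewrite eq_le measure_ge0 andbT.
  rewrite -[leRHS](_ : (0 ^+ #|pred1 l0|)%:E = 0%E); last by rewrite card1 expr1.
  apply: cube_measure_linear_cylinder => // [l i /eqP -> |l v /eqP -> /=].
    exact: cmin.
  rewrite [X in unit_uniform X](_ : _ = [set - v / c z.2 l0 0]).
    by apply: le_trans (unit_uniform_le (measurable_set1 _)) _; rewrite lebesgue_measure_set1.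
  apply/seteqP; split=> x /= => [/eqP|->].
    by rewrite addrC addr_eq0 => /eqP <-; rewrite mulrAC mulfV ?mul1r.
  by rewrite mulrC divfK // subrr.
pose F k := if unpickle k is Some z then if c z.2 == 0 then set0 else Z z else set0.
have mF k : measurable (F k) /\ cube_measure (m * p) (F k) = 0.
  rewrite /F; case: unpickle => [z|]; last by rewrite measure0.
  by case: eqP => [_|/eqP /hZ //]; rewrite measure0.
have mUF : measurable (\bigcup_k F k) by apply: bigcup_measurable => k _; case: (mF k).
exists (\bigcup_k F k); split=> //.
  apply/eqP; rewrite eq_le measure_ge0 andbT.
  apply: le_trans (generalized_Boole_inequality _ _ mUF) _.
    by move=> k; case: (mF k).
  by rewrite eseries0 // => k _ _; case: (mF k).
move=> x nFx q0 q hq.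
have [cz|cn] := eqVneq (c q) 0; last first.
  exfalso; apply: nFx; exists (pickle (q0, q)); first exact: I.
  rewrite /F pickleK (negPf cn); rewrite relE in hq; exact: hq.
have qr i j : q i (rshift 2 j) = 0.
  have /matrixP/(_ (entry_pos i j) 0) := cz; rewrite !mxE pos_rowK pos_colK => /eqP.
  by rewrite fmorph_eq0 => /eqP.
have rel : ratr q0 + \sum_i \sum_j ratr (lsubmx q i j) * A i j = 0.
  rewrite -[RHS]hq; congr (_ + _); apply: eq_bigr => i _.
  rewrite big_split_ord /= [X in _ = _ + X]big1 ?addr0; last first.
    by move=> j _; rewrite qr raddf0 mul0r.
  by apply: eq_bigr => j _; rewrite !mxE (unsplitK (inl _ : 'I_2 + 'I_p)).
have [q00 ql] := freeA q0 (lsubmx q) rel.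
split=> //; apply/matrixP => i j; rewrite mxE; case: (split_ordP j) => k ->.
  by have /matrixP/(_ i k) := ql; rewrite !mxE.
exact: qr.
Qed.
End GoodExtensions.

Lemma cube_measure_coordinate (R : realType) k (l : 'I_k)
    (E : set (measurableTypeR R)) : measurable E ->
  (cube_measure k [set x | E (tnth x l)] <= unit_uniform E)%E.
Proof.
move=> mE; elim: k l => [[] //|k IH l]; rewrite cube_measureSE.
have [<-|/unlift_some[j -> _]] := eqVneq ord0 l.
  rewrite (eq_integral (cst (unit_uniform E))) //.
  rewrite integral_cst // -[leRHS]mule1; apply: lee_wpmul2l => //.
  exact: probability_le1.
have mEj : measurable [set x : k.-tuple (measurableTypeR R) | E (tnth x j)].
  by rewrite -[X in measurable X]setTI; apply: measurable_tnth.
apply: le_trans (IH j); rewrite -[Y in (_ <= cube_measure k Y)%E]setIT -integral_indic //.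
rewrite le_eqVlt; apply/orP; left; apply/eqP; apply: eq_integral => t _.
rewrite indicE; have [tE|tE] := boolP (t \in _).
  rewrite -[RHS](probability_setT (unit_uniform (R := R))); congr unit_uniform.
  by apply/seteqP; split=> x //= _; rewrite tnthS; rewrite inE in tE.
rewrite -[RHS](measure0 (unit_uniform (R := R))); congr unit_uniform.
by apply/seteqP; split=> x //=; rewrite tnthS => h; case/negP: tE; rewrite inE.
Qed.

(** The measure lives on tuples of arbitrary reals, whereas [rank_diag_dominant] needs entries
    between 0 and 1. *)
Lemma cube_measure_support (R : realType) k :
  exists N : set (k.-tuple (measurableTypeR R)), [/\ measurable N,
    cube_measure k N = 0%E & forall x, ~ N x -> forall l, 0 <= tnth x l <= 1].
Proof.
pose mR := measurableTypeR R.
pose E : set mR := ~` `[0, 1].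
have mE : measurable E by apply: measurableC; exact: measurable_itv.
pose Z l := [set x : k.-tuple mR | if (l < k)%N =P true is ReflectT h
  then E (tnth x (Ordinal h)) else False].
have hZ l : measurable (Z l) /\ cube_measure k (Z l) = 0%E.
  rewrite /Z; case: eqP => [h|_]; last first.
    by rewrite (_ : [set _ | False] = set0) // measure0.
  split.
    rewrite -[Y in measurable Y]setTI.
    exact: (@measurable_tnth _ mR k (Ordinal h) measurableT _ mE).
  apply/eqP; rewrite eq_le measure_ge0 andbT.
  apply: le_trans (cube_measure_coordinate _ mE) _.
  by rewrite /unit_uniform /mrestr setICl measure0.
have mU : measurable (\bigcup_l Z l) by apply: bigcup_measurable => l _; case: (hZ l).
exists (\bigcup_l Z l); split=> // [|x nx l].
  apply/eqP; rewrite eq_le measure_ge0 andbT.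
  apply: le_trans (generalized_Boole_inequality _ _ mU) _.
    by move=> l; case: (hZ l).
  by rewrite eseries0 // => l _ _; case: (hZ l).
have : ~ E (tnth x l).
  move=> h; apply: nx; exists l => //; rewrite /Z /=; case: eqP => [lk|]; last by rewrite ltn_ord.
  by rewrite (_ : Ordinal lk = l) //; exact/val_inj.
by rewrite /E /setC /= in_itv /= => /contrapT.
Qed.

(** At a coordinate [i] where a left null vector [v] is largest, column [i] gives
    [m.+1 * |v i| <= m * |v i|], since [X] contributes [m] entries of size at most 1. *)
Lemma rank_diag_dominant (R : realType) m p (A : 'M[R]_(m, 2)) (X : 'M[R]_(m, p)) :
  (m <= p)%N -> (forall i j, 0 <= X i j <= 1) ->
  \rank (row_mx A ((\matrix_(i, j) if i == j :> nat then m.+1%:R else 0) + X)) = m.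
Proof.
move=> mp X01; set B := _ + X; apply/eqP; rewrite -[_ == _]/(row_free _) -kermx_eq0.
apply/rowV0P => v /sub_kermxP; rewrite mul_mx_row => vW.
have /eq_row_mx[_ vB] : row_mx (v *m A) (v *m B) = row_mx 0 0 by rewrite vW row_mx0.
apply/eqP; rewrite -normr_eq0; apply/negP => /negP vn.
have [i vi] : exists i, `|v| = `|v 0 i|.
  by have [[a i] /= vi] := mx_norm_neq0 vn; exists i; rewrite -(ord1 a).
have vmax k : `|v 0 k| <= `|v 0 i|.
  rewrite -vi [leRHS]mx_normrE.
  exact: (le_bigmax _ (fun ij => `|v ij.1 ij.2|) (0, k)).
have v0 : 0 < `|v 0 i| by rewrite -vi lt_def vn vi normr_ge0.
pose j := widen_ord mp i.
have /matrixP/(_ 0 j) := vB; rewrite !mxE.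
under eq_bigr => k _ do rewrite !mxE mulrDr.
rewrite big_split /= (bigD1 i) //= eqxx [Z in _ + Z + _]big1; last first.
  by move=> k; rewrite -val_eqE /= => /negPf ->; rewrite mulr0.
rewrite addr0.
move=> /eqP; rewrite addr_eq0 => /eqP e.
have : `|v 0 i * m.+1%:R| <= m%:R * `|v 0 i|.
  rewrite e normrN; apply: le_trans (ler_norm_sum _ _ _) _.
  apply: (@le_trans _ _ (\sum_(k < m) `|v 0 i|)).
    apply: ler_sum => k _; rewrite normrM; case/andP: (X01 k j) => x0 x1.
    by rewrite (ger0_norm x0) -[leRHS]mulr1 ler_pM.
  by rewrite sumr_const card_ord -[_ *+ m]mulr_natl.
by rewrite normrM mulrC ler_pM2r // normr_nat ler_nat ltnn.
Qed.

(** Solutions for the block extend by zero coordinates, so both solvability properties hold for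
    every extension; the lower bound, the independence and the rank hold for [x] in the limit
    superior of the good sets, off two null sets. *)
Lemma wide_family (R : realType) m p (c : R) : (0 < m)%N -> (2 * m <= 2 + p)%N ->
  0 < c -> let w : R := (2 + p)%:R / m%:R in
  exists (S : set ((m * p).-tuple (measurableTypeR R)))
    (F : (m * p).-tuple (measurableTypeR R) -> 'M[R]_(m, 2 + p)),
  [/\ measurable S, (0 < cube_measure (m * p) S)%E,
    forall x x' l, `|tnth x l - tnth x' l| <= `|F x - F x'| &
    forall x, S x -> [/\ uniformly_solvable w (F x) c,
      exists2 c', 0 < c' & often_unsolvable w (F x) c',
      often_well_solvable w (F x), entries_and_one_Q_free (F x) &
      (m <= p)%N -> \rank (F x) = m]].
Proof.
case: m => // m _ mp c0 w.
have w2 : 2 <= w.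
  by rewrite /w ler_pdivlMr ?ltr0n // -natrM ler_nat.
have [A [Au [c1 c10 An] Aw Af]] := @exists_two_columns R m w c w2 c0.
pose B0 : 'M[R]_(m.+1, p) := \matrix_(i, j) if i == j :> nat then m.+2%:R else 0.
have [delta delta0 hG] := @exists_good_extensions R m.+1 p isT A B0.
have [N1 [mN1 N10 hN1]] := @Q_free_extensions R m.+1 p A B0 Af.
have [N2 [mN2 N20 hN2]] := @cube_measure_support R (m.+1 * p).
(* The critical scales of the block; [k <= t k] makes them tend to infinity. *)
have /choice[t ht] : forall k : nat, exists t : R,
    [/\ 1 <= t, k%:R <= t & ~ solvable_at A t (c1 * t `^ (- w))].
  move=> k; have [t tk nt] := An (Num.max 1 k%:R); exists t; split=> //.
    by apply: le_trans tk; rewrite le_max lexx.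
  by apply: le_trans tk; rewrite le_max lexx orbT.
have /choice[G hGt] : forall k, exists G : set ((m.+1 * p).-tuple (measurableTypeR R)),
    [/\ measurable G, (2^-1%:E <= cube_measure (m.+1 * p) G)%E &
    forall x, G x -> forall (b : 'cV[int]_(2 + p)) (d : 'cV[int]_m.+1),
      dsubmx b != 0 -> (forall j, `|(b j 0)%:~R| <= t k) ->
      ~ forall i, `|(extension A B0 x *m int_vec b + int_vec d) i 0|
                    <= delta * t k `^ (- w)].
  by move=> k; apply: hG; case: (ht k).
have mG k : measurable (G k) by case: (hGt k).
have mGU k : measurable (\bigcup_(j in [set j | (k <= j)%N]) G j).
  by apply: bigcup_measurable => j _.
have mL : measurable (lim_sup_set G) by apply: bigcap_measurable.
(* The unions of the tails decrease to the limit superior, and each of them contains some [G k]. *)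
have muL : (2^-1%:E <= cube_measure (m.+1 * p) (lim_sup_set G))%E.
  have fin : (cube_measure (m.+1 * p) (\bigcup_(j in [set j | (0 <= j)%N]) G j) < +oo)%E.
    by apply: le_lt_trans (probability_le1 _ (mGU 0%N)) _; rewrite ltey.
  have cv := lim_sup_set_cvg (cube_measure (m.+1 * p)) G mG fin.
  rewrite -(cvg_lim _ cv) //; apply: lime_ge; first by apply/cvg_ex; eexists; exact: cv.
  near=> k; case: (hGt k) => _ + _; move=> h; apply: (le_trans h).
  by apply: le_measure; rewrite ?inE // => x Gx; exists k => /=.
exists (lim_sup_set G `\` (N1 `|` N2)), (extension A B0); split.
- by apply: measurableD => //; exact: measurableU.
- have N0 : cube_measure (m.+1 * p) (N1 `|` N2) = 0%E.
    apply/eqP; rewrite eq_le measure_ge0 andbT.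
    apply: (@le_trans _ _ (cube_measure (m.+1 * p) N1 + cube_measure (m.+1 * p) N2)%E).
      exact: measureU2.
    by rewrite N10 N20 adde0.
  have mN : measurable (N1 `|` N2) by exact: measurableU.
  apply: (@lt_le_trans _ _ (cube_measure (m.+1 * p) (lim_sup_set G))).
    by apply: lt_le_trans muL; rewrite lte_fin invr_gt0.
  have sub : lim_sup_set G `<=` (lim_sup_set G `\` (N1 `|` N2)) `|` (N1 `|` N2).
    by move=> x Lx; have [Nx|nNx] := pselect ((N1 `|` N2) x); [right|left].
  apply: (@le_trans _ _ (cube_measure (m.+1 * p)
      ((lim_sup_set G `\` (N1 `|` N2)) `|` (N1 `|` N2)))).
    apply: le_measure; rewrite ?inE //.
    by apply: measurableU => //; exact: measurableD.
  apply: (@le_trans _ _ (cube_measure (m.+1 * p) (lim_sup_set G `\` (N1 `|` N2)) +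
      cube_measure (m.+1 * p) (N1 `|` N2))%E).
    by apply: measureU2 => //; exact: measurableD.
  by rewrite N0 adde0.
- by move=> x x' l; exact: extension_entry_dist.
- move=> x [Lx nN]; have nN1 : ~ N1 x by move=> h; apply: nN; left.
  have nN2 : ~ N2 x by move=> h; apply: nN; right.
  split.
  + move: Au => [y [_ Au]]; exists (Num.max y 0); split; first exact: num_real.
    move=> z; rewrite gt_max => /andP[yz z0].
    by apply: solvable_at_row_mx; [exact: ltW|exact: Au].
  + exists (Num.min c1 delta); first by rewrite lt_min c10.
    move=> t0; pose k := Num.bound t0.
    have [j /= kj Gj] := Lx k I.
    have [tj1 tjj ntj] := ht j.
    exists (t j).
      apply: (le_trans _ tjj); apply: (@le_trans _ _ k%:R); last by rewrite ler_nat.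
      have [t00|/ltW t00] := leP 0 t0; first exact: ltW (archi_boundP t00).
      exact: le_trans t00 _.
    move=> /solvable_row_mx_split[sA|[b [d [b0 bt bd]]]].
      apply: ntj; apply: solvable_at_le sA => //.
      by rewrite ler_wpM2r ?powR_ge0 // ge_min lexx.
    case: (hGt j) => _ _ /(_ x Gj b d b0 bt); apply => i.
    apply: le_trans (bd i) _.
    by rewrite ler_wpM2r ?powR_ge0 // ge_min lexx orbT.
  + move=> eps t0 e0; have [t1 t1t s1] := Aw eps (Num.max 0 t0) e0.
    exists t1; first by apply: le_trans t1t; rewrite le_max lexx orbT.
    by apply: solvable_at_row_mx => //; apply: le_trans t1t; rewrite le_max lexx.
  + exact: hN1.
  + move=> mp'; apply: rank_diag_dominant => // i j; rewrite mxE.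
    exact: hN2.
Unshelve. all: by end_near.
Qed.

(** * Comparison with arbitrary norms *)

Section Norms.
Context {R : realType} (k : nat) (N : 'cV[R]_k -> R).
Hypothesis hN : is_norm N.

Lemma is_norm0 : N 0 = 0.
Proof. by rewrite -[0 in LHS](scale0r 0) (is_norm_scale hN) normr0 mul0r. Qed.

Lemma is_normN x : N (- x) = N x.
Proof. by rewrite -scaleN1r (is_norm_scale hN) normrN1 mul1r. Qed.

Lemma is_norm_ge0 x : 0 <= N x.
Proof.
have := is_norm_triangle hN x (- x).
by rewrite subrr is_norm0 is_normN; lra.
Qed.

Lemma is_norm_upper : exists2 K, 0 < K & forall (x : 'cV[R]_k) (c : R),
  0 <= c -> (forall j, `|x j 0| <= c) -> N x <= K * c.
Proof.
pose K := \sum_(j < k) N (delta_mx j 0).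
have K0 : 0 <= K by apply: sumr_ge0 => j _; exact: is_norm_ge0.
(* The summand 1 keeps the constant positive even for [k = 0]. *)
exists (K + 1) => [|x c c0 hx]; first by rewrite ltr_wpDl.
have -> : x = \sum_j x j 0 *: delta_mx j 0.
  rewrite [LHS]matrix_sum_delta; apply: eq_bigr => i _.
  by rewrite big_ord1.
apply: (@le_trans _ _ (\sum_j N (x j 0 *: delta_mx j 0))).
  elim/big_rec2: _ => [|j y z _ yz]; first by rewrite is_norm0.
  by apply: le_trans (is_norm_triangle hN _ _) _; rewrite lerD2l.
apply: (@le_trans _ _ (K * c)); last by rewrite ler_wpM2r // lerDl.
rewrite /K mulr_suml; apply: ler_sum => j _.
by rewrite (is_norm_scale hN) mulrC ler_wpM2l // is_norm_ge0.
Qed.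

(** Equivalence of norms: [N] has a positive minimum on the unit sphere of the maximum norm, and the
    constant is its inverse. The sphere is empty for [k = 0], which is treated apart. *)
Lemma is_norm_lower : exists2 K, 0 < K & forall (x : 'cV[R]_k) j, `|x j 0| <= K * N x.
Proof.
have [k00|k0] := posnP k.
  by exists 1 => // x j; have := ltn_ord j; rewrite {2}k00.
have [K K0 hK] := is_norm_upper.
pose A : set 'rV[R]_k := [set x | `|x| = 1].
have coord (x : 'rV[R]_k) j : `|x 0 j| <= `|x|.
  rewrite [leRHS]mx_normrE.
  exact: (le_bigmax _ (fun ij => `|x ij.1 ij.2|) (0, j)).
have lip (x y : 'rV[R]_k) : `|N x^T - N y^T| <= K * `|x - y|.
  have h (u v : 'rV[R]_k) : N u^T - N v^T <= K * `|u - v|.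
    have := is_norm_triangle hN (u - v)^T v^T; rewrite -linearD subrK.
    have : N (u - v)^T <= K * `|u - v|.
      by apply: hK => // j; rewrite mxE; exact: coord.
    lra.
  have := h x y; have := h y x; rewrite distrC ler_norml; lra.
have cN : continuous (fun x : 'rV[R]_k => N x^T).
  move=> x U /nbhs_ballP[e /= e0 eU]; apply/nbhs_ballP.
  exists (K^-1 * e) => [/=|y xy]; first by rewrite mulr_gt0 ?invr_gt0.
  rewrite -ball_normE /= in xy; apply: eU; rewrite -ball_normE /=.
  by apply: le_lt_trans (lip _ _) _; rewrite -ltr_pdivlMl.
have cA : compact A.
  apply: bounded_closed_compact.
    exists 1; split; first exact: num_real.
    by move=> y y1 x /= ->; exact: ltW.
  rewrite (_ : A = (fun x : 'rV[R]_k => `|x|) @^-1` [set 1]) //.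
  apply: closed_comp => [x _|]; last exact: closed_eq.
  exact: norm_continuous.
have A0 : A !=set0.
  pose v : 'rV[R]_k := const_mx 1.
  have v0 : v != 0.
    apply/eqP => /matrixP/(_ 0 (Ordinal k0)); rewrite !mxE => /eqP.
    by rewrite oner_eq0.
  exists (`|v|^-1 *: v); rewrite /A /= normrZ normfV normr_id mulVf //.
  by rewrite normr_eq0.
have [c Ac hc] := compact_EVT_min A0 cA (continuous_subspaceT cN).
have c0 : 0 < N c^T.
  rewrite lt_def is_norm_ge0 andbT; apply/eqP => /(is_norm_definite hN) c0.
  move: Ac; rewrite inE /A /= -[c]trmxK c0 trmx0 normr0 => /esym/eqP.
  by rewrite oner_eq0.
exists (N c^T)^-1; first by rewrite invr_gt0.
move=> x j; have [x0|x0] := eqVneq x 0.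
  by rewrite x0 mxE normr0 is_norm0 mulr0.
pose y : 'rV[R]_k := `|x^T|^-1 *: x^T.
have xT0 : 0 < `|x^T|.
  rewrite normr_gt0; apply: contraNneq x0 => h; by rewrite -[x]trmxK h trmx0.
have := hc y; rewrite inE /A /= /y normrZ normfV normr_id mulVf ?gt_eqF // => /(_ erefl).
rewrite linearZ /= trmxK (is_norm_scale hN) ger0_norm ?invr_ge0 //.
rewrite mulrC ler_pdivlMr // -ler_pdivlMl // => h.
by apply: le_trans h; have := coord x^T j; rewrite mxE.
Qed.
End Norms.

Section ThetaBounds.
Context {R : realType} (m n : nat).
Variables (N1 : 'cV[R]_n -> R) (N2 : 'cV[R]_m -> R).
Hypotheses (hN1 : is_norm N1) (hN2 : is_norm N2).
Let w : R := n%:R / m%:R.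

Let w0 : 0 <= w. Proof. by rewrite divr_ge0. Qed.

(* The multiplier j makes N1 (j b) >= 1 for every nonzero integral b, as the
   definition of psi requires. *)
Lemma scaled_psi_le : exists h K : R, [/\ 0 < h, 0 < K &
  forall (W : 'M[R]_(m, n)) t c, 0 < t -> 0 <= c ->
    solvable_at W t (c * t `^ (- w)) -> (scaled_psi N1 N2 W (h * t)
      <= (K * c)%:E)%E].
Proof.
have [K1 K10 up1] := is_norm_upper hN1; have [L1 L10 low1] := is_norm_lower hN1.
have [K2 K20 up2] := is_norm_upper hN2.
pose j := (Num.bound L1).+1.
have jL : L1 <= j%:R.
  by apply: le_trans (ltW (archi_boundP (ltW L10))) _; rewrite ler_nat.
have j0 : 0 < j%:R :> R by rewrite ltr0n.
have h0 : 0 < j%:R * K1 by rewrite mulr_gt0.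
exists (j%:R * K1), ((j%:R * K1) `^ w * (j%:R * K2)); split=> //.
  by rewrite mulr_gt0 ?powR_gt0 // mulr_gt0.
move=> W t c t0 c0 [b [d [b0 bt bd]]]; rewrite /scaled_psi.
have jE (k : nat) (v : 'cV[int]_k) : int_vec (v *+ j) = j%:R *: int_vec v :> 'cV[R]_k.
  by apply/matrixP => i l; rewrite [LHS]mxE mulmxnE [RHS]mxE [in RHS]mxE rmorphMn mulr_natl.
have tw0 : 0 < t `^ w by rewrite powR_gt0.
have N2le : N2 (W *m int_vec (b *+ j) + int_vec (d *+ j))
    <= j%:R * K2 * (c * t `^ (- w)).
  rewrite !jE -scalemxAr -scalerDr (is_norm_scale hN2) gtr0_norm // -mulrA.
  by rewrite ler_pM2l //; apply: up2 => //; rewrite mulr_ge0 ?powR_ge0.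
apply: (@le_trans _ _ (((j%:R * K1 * t) `^ w)%:E * (j%:R * K2 * (c * t `^ (- w)))%:E)%E).
  apply: lee_wpmul2l; first by rewrite lee_fin powR_ge0.
  rewrite /psi; apply: ge_ereal_inf; exists (N2 (W *m int_vec (b *+ j) + int_vec (d *+ j)))%:E.
    exists (b *+ j, d *+ j) => //=.
    rewrite jE (is_norm_scale hN1) gtr0_norm //; apply/andP; split; last first.
      by rewrite -mulrA ler_pM2l // up1 ?ltW // => i; rewrite mxE.
    have [i bi] : exists i, b i 0 != 0.
      apply/existsP; rewrite -[X in is_true X]negbK; apply/negP => /existsPn h.
      case/eqP: b0; apply/matrixP => i l; rewrite ord1 mxE.
      by apply/eqP; rewrite -[_ == _]negbK; exact: h.
    have : 1 <= `|(b i 0)%:~R| :> R.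
      by rewrite -intr_norm -[1]/(1%:~R) ler_int -gtz0_ge1 normr_gt0.
    have := low1 (int_vec b) i; rewrite mxE => h1 h2.
    apply: le_trans h2 _; apply: le_trans h1 _.
    by rewrite ler_wpM2r // (is_norm_ge0 hN1).
  by rewrite lee_fin.
rewrite -EFinM lee_fin powRM ?(ltW h0) ?(ltW t0) // powRN le_eqVlt; apply/orP; left.
by apply/eqP; field; rewrite gt_eqF.
Qed.

(** An admissible pair with a smaller value would be a solution: [b] is nonzero because [N1 b >= 1],
    and its coordinates are at most [L1 * N1 b <= t], which dictates [h = L1^-1]. *)
Lemma scaled_psi_ge : exists h K : R, [/\ 0 < h, 0 < K &
  forall (W : 'M[R]_(m, n)) t c, 0 < t -> 0 <= c ->
    ~ solvable_at W t (c * t `^ (- w)) -> ((K * c)%:E <=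
      scaled_psi N1 N2 W (h * t))%E].
Proof.
have [L1 L10 low1] := is_norm_lower hN1; have [L2 L20 low2] := is_norm_lower hN2.
exists L1^-1, (L1^-1 `^ w / L2); split; rewrite ?invr_gt0 //.
  by rewrite divr_gt0 // powR_gt0 // invr_gt0.
move=> W t c t0 c0 ns; rewrite /scaled_psi.
have tw0 : 0 < t `^ w by rewrite powR_gt0.
apply: (@le_trans _ _ (((L1^-1 * t) `^ w)%:E * (c * t `^ (- w) / L2)%:E)%E).
  rewrite -EFinM lee_fin powRM ?invr_ge0 ?(ltW L10) ?(ltW t0) // powRN.
  by rewrite le_eqVlt; apply/orP; left; apply/eqP; field; rewrite !gt_eqF.
apply: lee_wpmul2l; first by rewrite lee_fin powR_ge0.
apply: le_ereal_inf_tmp => _ [[b d] /= /andP[b1 bt] <-]; rewrite lee_fin.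
rewrite leNgt; apply/negP => hlt; apply: ns; exists b, d; split.
- apply: contraTneq b1 => ->; rewrite (_ : int_vec 0 = 0) ?(is_norm0 hN1) ?ler10 //.
  by apply/matrixP => i j; rewrite !mxE.
- move=> j; have := low1 (int_vec b) j; rewrite mxE => h; apply: le_trans h _.
  by rewrite -ler_pdivlMl.
- move=> i; apply: le_trans (low2 _ i) _.
  by rewrite -ler_pdivlMl // mulrC ltW.
Qed.

Lemma Theta_le : exists2 K : R, 0 < K & forall (W : 'M[R]_(m, n)) c, 0 <= c ->
  uniformly_solvable w W c -> (Theta N1 N2 W <= (K * c)%:E)%E.
Proof.
have [h [K [h0 K0 hle]]] := scaled_psi_le; exists K => // W c c0 [M [_ hM]].
rewrite /Theta limf_esupE; apply: ge_ereal_inf.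
exists (ereal_sup (scaled_psi N1 N2 W @` [set t | h * Num.max 0 M < t])).
  exists [set t | h * Num.max 0 M < t] => //.
  by exists (h * Num.max 0 M); split=> //; exact: num_real.
apply: ge_ereal_sup => _ [t /= Mt <-].
have : Num.max 0 M < h^-1 * t by rewrite ltr_pdivlMl.
rewrite gt_max => /andP[t0 tM].
by have := hle W (h^-1 * t) c t0 c0 (hM _ tM); rewrite mulVKf // gt_eqF.
Qed.

Lemma Theta_ge : exists2 K : R, 0 < K & forall (W : 'M[R]_(m, n)) c, 0 <= c ->
  often_unsolvable w W c -> ((K * c)%:E <= Theta N1 N2 W)%E.
Proof.
have [h [K [h0 K0 hge]]] := scaled_psi_ge; exists K => // W c c0 hW.
rewrite /Theta limf_esupE; apply: le_ereal_inf_tmp => _ [V [M [_ hM]] <-].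
have [t tM nt] := hW (Num.max 1 (h^-1 * (M + 1))).
have t0 : 0 < t by apply: lt_le_trans tM; rewrite lt_max ltr01.
apply: le_ereal_sup_tmp; exists (scaled_psi N1 N2 W (h * t)); last exact: hge.
exists (h * t) => //; apply: hM; rewrite -ltr_pdivrMl //.
by apply: lt_le_trans tM; rewrite lt_max ltr_pM2l ?invr_gt0 // ltrDl ltr01 orbT.
Qed.

Lemma not_Bad (W : 'M[R]_(m, n)) : often_well_solvable w W -> ~ Bad N1 N2 W.
Proof.
move=> hW; apply/negP; rewrite -leNgt /Theta_inf /limf_einf leeNl oppe0.
have [h [K [h0 K0 hle]]] := scaled_psi_le.
rewrite limf_esupE; apply: le_ereal_inf_tmp => _ [V [M [_ hM]] <-].
apply/lee_addgt0Pr => e e0.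
have [t tM st] := hW (e / K) (Num.max 1 (h^-1 * (M + 1))) (divr_gt0 e0 K0).
have t0 : 0 < t by apply: lt_le_trans tM; rewrite lt_max ltr01.
have hMt : M < h * t.
  rewrite -ltr_pdivrMl //.
  by apply: lt_le_trans tM; rewrite lt_max ltr_pM2l ?invr_gt0 // ltrDl ltr01 orbT.
have := hle W t (e / K) t0 (ltW (divr_gt0 e0 K0)) st.
have -> : K * (e / K) = e by rewrite mulrC divfK ?gt_eqF.
move=> hs.
rewrite -leeBlDr // sub0e; apply: le_ereal_sup_tmp.
exists (- scaled_psi N1 N2 W (h * t))%E; last by rewrite leeN2.
by exists (h * t) => //; exact: hM.
Qed.
End ThetaBounds.

(** * The theorem *)

Lemma mx_norm_trmx_le (R : realType) m n (A : 'M[R]_(m, n)) : `|A| <= `|A^T|.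
Proof.
have [->//|A0] := eqVneq `|A| 0.
have [[i j] /= e] := mx_norm_neq0 A0.
apply: (@le_trans _ _ `|A^T j i|); first by rewrite mxE -e.
rewrite [leRHS]mx_normrE.
exact: (le_bigmax _ (fun ij => `|A^T ij.1 ij.2|) (j, i)).
Qed.

Lemma entries_and_one_Q_free_trmx (R : realType) m n (A : 'M[R]_(m, n)) :
  entries_and_one_Q_free A -> entries_and_one_Q_free A^T.
Proof.
move=> hA q0 q hq; have [q00 qT] : q0 = 0 /\ q^T = 0.
  apply: hA; rewrite -[RHS]hq exchange_big; congr (_ + _).
  by apply: eq_bigr => i _; apply: eq_bigr => j _; rewrite !mxE.
by split=> //; rewrite -[q]trmxK qT trmx0.
Qed.

Section Family.
Context {R : realType} (m n : nat).

Definition small_Theta_family k (S : set (k.-tuple (measurableTypeR R)))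
    (F : k.-tuple (measurableTypeR R) -> 'M[R]_(m, n)) (c : R) : Prop :=
  let w : R := n%:R / m%:R in
  [/\ measurable S, (0 < cube_measure k S)%E,
    forall x x' l, `|tnth x l - tnth x' l| <= `|F x - F x'| &
    forall x, S x -> [/\ uniformly_solvable w (F x) c,
      exists2 c', 0 < c' & often_unsolvable w (F x) c',
      often_well_solvable w (F x), entries_and_one_Q_free (F x) &
      (0 < k)%N -> \rank (F x) = minn m n]].

Lemma ratio_cases : (0 < n)%N ->
  ~ (2^-1 < m%:R / n%:R :> R /\ m%:R / n%:R < 2 :> R) ->
  (2 * m <= n)%N \/ (2 * n <= m)%N.
Proof.
move=> n0 h; have nR : 0 < n%:R :> R by rewrite ltr0n.
rewrite -2!(ler_nat R) !natrM; have [|h1] := leP (2 * m%:R) (n%:R : R); first by left.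
right; rewrite leNgt; apply/negP => h2; apply: h.
by rewrite ltr_pdivlMr // ltr_pdivrMr //; split; lra.
Qed.

End Family.

Lemma exists_family (R : realType) m n (c : R) : (0 < m)%N -> (0 < n)%N ->
  (2 * m <= n)%N \/ (2 * n <= m)%N -> 0 < c ->
  exists k S F, @small_Theta_family R m n k S F c /\
    k%:R = ((maxn m n)%:R - 2) * (minn m n)%:R :> R.
Proof.
move=> m0 n0 + c0.
(* If [a <= p] fails then [p = 0], the case of dimension 0, where no rank is claimed. *)
have rk a p : (0 < a)%N -> (2 * a <= 2 + p)%N -> (0 < a * p)%N -> (a <= p)%N.
  by move=> a0 ap; rewrite muln_gt0 => /andP[_ p0]; lia.
have dimE a p : (a * p)%:R = ((2 + p)%:R - 2) * a%:R :> R.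
  by rewrite natrM natrD; ring.
case=> h.
- have [p np] : exists p, n = (2 + p)%N by exists (n - 2)%N; lia.
  subst n; have [S [F [mS S0 FL FS]]] := wide_family m0 h c0.
  exists (m * p)%N, S, F; have mn : (m <= 2 + p)%N by lia.
  rewrite (maxn_idPr mn) (minn_idPl mn) dimE; split=> //; split=> // x Sx.
  have [u1 u2 u3 u4 u5] := FS x Sx; split=> // k0.
  by rewrite u5 ?(minn_idPl mn) // rk.
- have [p np] : exists p, m = (2 + p)%N by exists (m - 2)%N; lia.
  subst m; have [e e0 hu] := @uniformly_solvable_trmx R (2 + p) n c isT n0 c0.
  have [S [F [mS S0 FL FS]]] := wide_family n0 h e0.
  exists (n * p)%N, S, (fun x => (F x)^T); have mn : (n <= 2 + p)%N by lia.
  rewrite (maxn_idPl mn) (minn_idPr mn) dimE; split=> //; split=> //.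
    move=> x x' l; apply: le_trans (FL x x' l) _.
    by apply: le_trans (mx_norm_trmx_le _) _; rewrite linearB.
  move=> x Sx; have [u1 [c1 c10 u2] u3 u4 u5] := FS x Sx; split.
  + by apply: hu; rewrite trmxK.
  + by apply: often_unsolvable_trmx c10 u2.
  + by apply: often_well_solvable_trmx => //; rewrite trmxK.
  + exact: entries_and_one_Q_free_trmx.
  + by move=> k0; rewrite mxrank_tr u5 ?(minn_idPr mn) // rk.
Qed.

(** Used twice: on a singleton, to get a positive real below one value of [Theta], and on the
    spectrum, where arbitrarily small positive values contradict the gap. *)
Lemma finite_set_pos_gap (R : realType) (A : set (\bar R)) : finite_set A ->
  exists2 e : R, 0 < e & forall y, A y -> (0 < y)%E -> (e%:E < y)%E.
Proof.
case/finite_seqP => s ->; elim: s => [|y s [e e0 he]].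
  by exists 1 => // y; rewrite /= in_nil.
have [d d0 hd] : exists2 d : R, 0 < d & ((0 < y)%E -> (d%:E < y)%E).
  case: y => [r| |]; [|by exists 1 => // _; rewrite ltey|by exists 1 => //; rewrite ltNge leNye].
  have [r0|r0] := ltP 0 r; last by exists 1 => //; rewrite lte_fin ltNge r0.
  by exists (r / 2); rewrite ?divr_gt0 // => _; rewrite lte_fin; lra.
exists (Num.min e d); first by rewrite lt_min e0.
move=> z /=; rewrite inE => /predU1P[->|zs] z0.
  by apply: le_lt_trans (hd z0); rewrite lee_fin ge_min lexx orbT.
by apply: le_lt_trans (he z zs z0); rewrite lee_fin ge_min lexx.
Qed.

Unset Implicit Arguments.
Set Strict Implicit.
Set Printing Implicit Defensive.

Theorem theorem3p7 (R : realType) (m n : nat) (hm : (0 < m)%N) (hn : (0 < n)%N)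
    (hratio : ~ (2^-1 < m%:R / n%:R :> R /\ m%:R / n%:R < 2 :> R))
    (hpair : (m, n) \notin [:: (1, 3); (3, 1); (2, 4); (4, 2)]%N)
    (N1 : 'cV[R]_n -> R) (N2 : 'cV[R]_m -> R)
    (hN1 : is_norm N1) (hN2 : is_norm N2) :
  [/\ ((((maxn m n)%:R - 2) * (minn m n)%:R)%:E
         <= hausdorff_dim (FS N1 N2))%E,
      ((maxn m n)%:R - 2) * (minn m n)%:R
        = (m * n)%:R - 2 * (minn m n)%:R :> R,
      ((((maxn m n)%:R - 2) * (minn m n)%:R)%:E
         <= hausdorff_dim (FS N1 N2 `&`
              [set W | \rank W = minn m n /\ entries_and_one_Q_free W]))%E,
      limit_point (dirichlet_spectrum N1 N2) 0%E &
      ~ finite_set (dirichlet_spectrum N1 N2)].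
Proof.
have ratio := ratio_cases hn hratio.
have [Ku Ku0 hKu] := Theta_le hN1 hN2.
have [Kl Kl0 hKl] := Theta_ge hN1 hN2.
have small (e : R) : 0 < e -> exists k S F, @small_Theta_family R m n k S F (e / Ku) /\
    k%:R = ((maxn m n)%:R - 2) * (minn m n)%:R :> R /\
    forall x, S x -> (0 < Theta N1 N2 (F x) <= e%:E)%E.
  move=> e0; have c0 : 0 < e / Ku by rewrite divr_gt0.
  have [k [S [F [hF kE]]]] := exists_family hm hn ratio c0.
  exists k, S, F; split=> //; split=> // x Sx; case: hF => _ _ _ /(_ x Sx).
  case=> u1 [c' c'0 u2] _ _ _; apply/andP; split.
    by apply: (lt_le_trans _ (hKl _ _ (ltW c'0) u2)); rewrite lte_fin mulr_gt0.
  by have := hKu _ _ (ltW c0) u1; rewrite mulrC divfK ?gt_eqF.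
have nonempty k (S : set (k.-tuple (measurableTypeR R))) :
    (0 < cube_measure k S)%E -> exists x, S x.
  move=> S0; apply: contrapT => nS; move: S0; rewrite (_ : S = set0) ?measure0 ?ltxx //.
  by apply/seteqP; split=> x // Sx; apply: nS; exists x.
have smallW (e : R) : 0 < e -> exists W, (0 < Theta N1 N2 W <= e%:E)%E.
  move=> /small[k [S [F [[_ S0 _ _] [_ hS]]]]].
  by have [x Sx] := nonempty k S S0; exists (F x); exact: hS.
have dim : ((((maxn m n)%:R - 2) * (minn m n)%:R)%:E
         <= hausdorff_dim (FS N1 N2 `&`
              [set W | \rank W = minn m n /\ entries_and_one_Q_free W]))%E.
  (* Membership in [Di] needs a value of [Theta] above those of the family: [W0] supplies it, and
     the family is then taken with [Theta <= d < Theta W0]. *)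
  have [W0 /andP[W00 W01]] := smallW 1 ltr01.
  have [d d0 dW0] : exists2 d : R, 0 < d & (d%:E < Theta N1 N2 W0)%E.
    have [d d0 hd] := finite_set_pos_gap (finite_set1 (Theta N1 N2 W0)).
    by exists d => //; exact: hd.
  have [k [S [F [[mS S0 FL FS'] [<- hS]]]]] := small d d0.
  (* For [k = 0] the bound is nonnegativity of the dimension; for [k > 0] the rank clause of the
     family is available. *)
  have [->|k0] := posnP k; first exact: hausdorff_dim_ge0.
  apply: (hausdorff_dim_ge_cube mS S0 _ FL) => x Sx.
  have [_ _ u3 u4 u5] := FS' x Sx; have /andP[T0 Td] := hS x Sx.
  split; last by split; [exact: u5|].
  split.
    apply: (le_lt_trans Td); apply: (lt_le_trans dW0).
    by apply: ereal_sup_ubound; exists W0.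
  move=> [|Tx]; first exact: not_Bad.
  by move: T0; rewrite [X in (_ < X)%E]Tx ltxx.
split=> //.
- apply: le_trans dim _; apply: hausdorff_dim_le; exact: subIsetl.
- rewrite mulrBl; congr (_ - _); rewrite -natrM; congr (_%:R).
  by have [h|/ltnW h] := leqP m n; [rewrite mulnC|].
- move=> U U0.
  have [e /= e0 eU] : exists2 e : R, 0 < e & forall r : R, `|r| < e -> U r%:E.
    have /nbhs_ballP[e /= e0 he] : nbhs (0 : R) (fun r => U r%:E) by exact: U0.
    by exists e => // r re; apply: he; rewrite /ball /= sub0r normrN.
  have e20 : 0 < e / 2 by rewrite divr_gt0.
  have [W /andP[W0 We]] := smallW (e / 2) e20.
  exists (Theta N1 N2 W); split; [by rewrite gt_eqF|by exists W|].
  move: W0 We; case: (Theta N1 N2 W) => [r| |] //.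
  rewrite lte_fin lee_fin => r0 re; apply: eU; rewrite gtr0_norm //.
  by apply: le_lt_trans re _; rewrite ltr_pdivrMr // ltr_pMr // ltr1n.
- move=> /finite_set_pos_gap[e e0 he]; have [W /andP[W0 We]] := smallW e e0.
  have WS : dirichlet_spectrum N1 N2 (Theta N1 N2 W) by exists W.
  by have := he _ WS W0; rewrite ltNge We.
Qed.
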